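(* Suppose that $V$ is a model of $\mathsf{IZF}$ and $M\subseteq V$ is a definable, transitive proper class which has an external cumulative hierarchy. Then $M$ is a model of $\mathsf{IZF}$ if and only if $M$ is closed under the fundamental operations and $M$ is almost universal.
   Context: $\mathsf{IZF}$ is the theory with intuitionistic logic whose axioms are Extensionality, Empty Set, Pairing, Unions, Power Set, Strong Infinity, Set Induction scheme, full Separation scheme and full Collection scheme. An ordinal is a transitive set of transitive sets. $M$ has an external cumulative hierarchy (in $V$) if there is a sequence $\langle M_\alpha:\alpha\in\mathrm{Ord}\cap V\rangle$, definable in $V$, such that $M_\alpha\in M$ for every ordinal $\alpha$ of $V$, $M=\bigcup\{M_\alpha:\alpha\in\mathrm{Ord}\cap V\}$, and $\beta\in\alpha$ implies $M_\beta\subseteq M_\alpha$. $M$ is almost universal if for every set $x\in V$ with $x\subseteq M$ there is $y\in M$ with $x\subseteq y$. With $\langle a,b\rangle=\{\{a\},\{a,b\}\}$, $\langle a,b,c\rangle=\langle a,\langle b,c\rangle\rangle$, $1^{st}(\langle a,b\rangle)=a$, $2^{nd}(\langle a,b\rangle)=b$, the fundamental operations are the binary operations: $\{x,y\}$; $x\cap\bigcap y$; $\bigcup x$; $x\setminus y$; $x\times y$; $x\cap\{z: y\text{ is an ordered pair}\wedge(z\in 1^{st}(y)\to z\in 2^{nd}(y))\}$; $\{\{u:\langle z,u\rangle\in x\}:z\in y\}$; $\mathrm{dom}(x)=\{1^{st}(z):z\in x,\ z\text{ an ordered pair}\}$; $\mathrm{ran}(x)=\{2^{nd}(z):z\in x,\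 z\text{ an ordered pair}\}$; $\{\langle u,v,w\rangle:\langle u,v\rangle\in x\wedge w\in y\}$; $\{\langle u,w,v\rangle:\langle u,v\rangle\in x\wedge w\in y\}$; $\{\langle v,u\rangle\in y\times x:u=v\}$; $\{\langle v,u\rangle\in y\times x:u\in v\}$. $M$ is closed under them if applying any of them to elements of $M$ yields an element of $M$. *)

(* Defs.v *)
From mathcomp Require Import all_boot.

Set Implicit Arguments.
Unset Strict Implicit.
Unset Printing Implicit Defensive.

(* Intuitionistic first-order logic is interpreted in an arbitrary complete   *)
(* Heyting algebra: Rocq's Prop is one instance (given propositional          *)
(* extensionality), and quantifying over all of them keeps the logic          *)
(* intuitionistic even when the metatheory is classical.                      *)
Record cHeyting := CHeyting {
  truth :> Type;
  le : truth -> truth -> Prop;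
  top : truth;
  bot : truth;
  conj : truth -> truth -> truth;
  disj : truth -> truth -> truth;
  impl : truth -> truth -> truth;
  inf : forall I : Type, (I -> truth) -> truth;
  sup : forall I : Type, (I -> truth) -> truth;
  le_refl : forall p, le p p;
  le_trans : forall q p r, le p q -> le q r -> le p r;
  le_antisym : forall p q, le p q -> le q p -> p = q;
  le_top : forall p, le p top;
  le_bot : forall p, le bot p;
  le_conj : forall p q r, le r (conj p q) <-> le r p /\ le r q;
  disj_le : forall p q r, le (disj p q) r <-> le p r /\ le q r;
  le_impl : forall p q r, le r (impl p q) <-> le (conj r p) q;
  le_inf : forall (I : Type) (F : I -> truth) r,
    le r (inf F) <-> (forall i, le r (F i));
  sup_le : forall (I : Type) (F : I -> truth) r,
    le (sup F) r <-> (forall i, le (F i) r)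
}.

Arguments le {_} _ _.
Arguments top {_}.
Arguments bot {_}.
Arguments conj {_} _ _.
Arguments disj {_} _ _.
Arguments impl {_} _ _.
Arguments inf {_} {_} _.
Arguments sup {_} {_} _.

Definition iff_val (O : cHeyting) (p q : O) : O :=
  conj (impl p q) (impl q p).

Declare Scope truth_scope.
Delimit Scope truth_scope with truth.

Notation "p ⊓ q" := (conj p q)
  (at level 76, right associativity) : truth_scope.
Notation "p ⊔ q" := (disj p q)
  (at level 77, right associativity) : truth_scope.
Notation "p ⇒ q" := (impl p q)
  (at level 78, right associativity) : truth_scope.
Notation "p ⇔ q" := (iff_val p q)
  (at level 79, no associativity) : truth_scope.
Notation "∼ p" := (impl p bot)
  (at level 75, right associativity) : truth_scope.
Notation "⋀ x , p" := (inf (fun x => p))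
  (at level 200, x name, right associativity) : truth_scope.
Notation "⋁ x , p" := (sup (fun x => p))
  (at level 200, x name, right associativity) : truth_scope.
Notation "⋀ x ':in' D , p" := (inf (fun x => impl (D x) p))
  (at level 200, x name, D at level 60, right associativity) : truth_scope.
Notation "⋁ x ':in' D , p" := (sup (fun x => conj (D x) p))
  (at level 200, x name, D at level 60, right associativity) : truth_scope.
Notation "⊩ p" := (le top p%truth) (at level 200).

Local Open Scope truth_scope.

(* A structure for the language {∈, =} with truth values in O.               *)
Record structure (O : cHeyting) := Structure {
  carrier :> Type;
  mem_val : carrier -> carrier -> O;
  eq_val : carrier -> carrier -> O;
  eq_val_refl : forall x, ⊩ eq_val x x;
  eq_val_sym : forall x y, le (eq_val x y) (eq_val y x);
  eq_val_trans : forall x y z, le (eq_val x y ⊓ eq_val y z) (eq_val x z);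
  mem_val_congr : forall x x' y y',
    le (eq_val x x' ⊓ eq_val y y' ⊓ mem_val x y) (mem_val x' y')
}.

Notation "x ∈ y" := (mem_val x y) (at level 70, no associativity) : truth_scope.
Notation "x ≈ y" := (eq_val x y) (at level 70, no associativity) : truth_scope.

(* [form n]: formulas of set theory whose free variables are indexed by 'I_n; *)
(* a quantifier binds variable 0 and shifts the other ones by one.            *)
Inductive form : nat -> Type :=
| Fmem n of 'I_n & 'I_n : form n
| Feq n of 'I_n & 'I_n : form n
| Fbot n : form n
| Fand n of form n & form n : form n
| For n of form n & form n : form n
| Fimp n of form n & form n : form n
| Fall n of form n.+1 : form n
| Fex n of form n.+1 : form n.

Definition scons (T : Type) n (x : T) (e : 'I_n -> T) (i : 'I_n.+1) : T :=
  if unlift ord0 i is Some j then e j else x.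

Section SetTheory.

Variables (O : cHeyting) (V : structure O).

Implicit Types (x y z a b : V).

(* The truth value of the relativization of the formula to the class D.       *)
Fixpoint sat (D : V -> O) n (phi : form n) : ('I_n -> V) -> O :=
  match phi in form n return ('I_n -> V) -> O with
  | Fmem n i j => fun e => e i ∈ e j
  | Feq n i j => fun e => e i ≈ e j
  | Fbot n => fun e => bot
  | Fand n f g => fun e => sat D f e ⊓ sat D g e
  | For n f g => fun e => sat D f e ⊔ sat D g e
  | Fimp n f g => fun e => sat D f e ⇒ sat D g e
  | Fall n f => fun e => ⋀ x :in D, sat D f (scons x e)
  | Fex n f => fun e => ⋁ x :in D, sat D f (scons x e)
  end.

Definition univ : V -> O := fun _ => top.

(* Definability in V, with parameters.                                        *)
Definition definable_class (M : V -> O) : Prop :=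
  exists n (phi : form n.+1) (e : 'I_n -> V),
    forall x, M x = sat univ phi (scons x e).

Definition definable_rel (R : V -> V -> O) : Prop :=
  exists n (phi : form n.+2) (e : 'I_n -> V),
    forall x y, R x y = sat univ phi (scons x (scons y e)).

(* The axioms of IZF relativized to D: all quantifiers range over D,          *)
(* including those hidden in "subset", "empty" and "successor".               *)

Definition sub_in (D : V -> O) x y : O := ⋀ z :in D, z ∈ x ⇒ z ∈ y.

Definition empty_in (D : V -> O) x : O := ⋀ z :in D, ∼ (z ∈ x).

Definition succ_in (D : V -> O) x s : O :=
  ⋀ z :in D, z ∈ s ⇔ z ∈ x ⊔ z ≈ x.

Definition inductive_in (D : V -> O) a : O :=
  (⋁ z :in D, empty_in D z ⊓ z ∈ a) ⊓
  (⋀ x :in D, x ∈ a ⇒ ⋁ s :in D, succ_in D x s ⊓ s ∈ a).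

Definition params_in (D : V -> O) n (e : 'I_n -> V) : O := ⋀ i, D (e i).

Definition Extensionality (D : V -> O) : O :=
  ⋀ x :in D, ⋀ y :in D, (⋀ z :in D, z ∈ x ⇔ z ∈ y) ⇒ x ≈ y.

Definition EmptySet (D : V -> O) : O := ⋁ x :in D, empty_in D x.

Definition Pairing (D : V -> O) : O :=
  ⋀ x :in D, ⋀ y :in D, ⋁ z :in D, ⋀ w :in D, w ∈ z ⇔ w ≈ x ⊔ w ≈ y.

Definition Unions (D : V -> O) : O :=
  ⋀ x :in D, ⋁ u :in D, ⋀ z :in D, z ∈ u ⇔ ⋁ y :in D, y ∈ x ⊓ z ∈ y.

Definition PowerSet (D : V -> O) : O :=
  ⋀ x :in D, ⋁ y :in D, ⋀ z :in D, z ∈ y ⇔ sub_in D z x.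

Definition StrongInfinity (D : V -> O) : O :=
  ⋁ a :in D, inductive_in D a ⊓
    (⋀ b :in D, inductive_in D b ⇒ sub_in D a b).

Definition SetInduction (D : V -> O) n (phi : form n.+1) : O :=
  ⋀ e :in params_in D (n := n),
    (⋀ a :in D, (⋀ x :in D, x ∈ a ⇒ sat D phi (scons x e)) ⇒
                sat D phi (scons a e)) ⇒
    ⋀ a :in D, sat D phi (scons a e).

Definition Separation (D : V -> O) n (phi : form n.+1) : O :=
  ⋀ e :in params_in D (n := n),
    ⋀ a :in D, ⋁ b :in D, ⋀ x :in D,
      x ∈ b ⇔ x ∈ a ⊓ sat D phi (scons x e).

Definition Collection (D : V -> O) n (phi : form n.+2) : O :=
  ⋀ e :in params_in D (n := n),
    ⋀ a :in D,
      (⋀ x :in D, x ∈ a ⇒ ⋁ y :in D, sat D phi (scons x (scons y e))) ⇒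
      ⋁ b :in D, ⋀ x :in D, x ∈ a ⇒
        ⋁ y :in D, y ∈ b ⊓ sat D phi (scons x (scons y e)).

Record model_IZF (D : V -> O) : Prop := ModelIZF {
  izf_extensionality : ⊩ Extensionality D;
  izf_empty_set : ⊩ EmptySet D;
  izf_pairing : ⊩ Pairing D;
  izf_unions : ⊩ Unions D;
  izf_power_set : ⊩ PowerSet D;
  izf_strong_infinity : ⊩ StrongInfinity D;
  izf_set_induction : forall n (phi : form n.+1), ⊩ SetInduction D phi;
  izf_separation : forall n (phi : form n.+1), ⊩ Separation D phi;
  izf_collection : forall n (phi : form n.+2), ⊩ Collection D phi
}.

Definition transitive_class (M : V -> O) : Prop :=
  ⊩ ⋀ x :in M, ⋀ y, y ∈ x ⇒ M y.

Definition proper_class (M : V -> O) : Prop :=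
  ⊩ ∼ (⋁ y, ⋀ x, x ∈ y ⇔ M x).

Definition transitive_set x : O := ⋀ y, y ∈ x ⇒ sub_in univ y x.

Definition is_ordinal a : O := transitive_set a ⊓ ⋀ x, x ∈ a ⇒ transitive_set x.

(* [R a y] reads "y = M_a".                                                   *)
Record cumulative_hierarchy (M : V -> O) (R : V -> V -> O) : Prop := CumHier {
  hier_definable : definable_rel R;
  hier_functional :
    ⊩ ⋀ a :in is_ordinal, ⋁ y, R a y ⊓ ⋀ z, R a z ⇒ z ≈ y;
  hier_in : ⊩ ⋀ a :in is_ordinal, ⋀ y, R a y ⇒ M y;
  hier_union : ⊩ ⋀ x, M x ⇔ ⋁ a :in is_ordinal, ⋁ y, R a y ⊓ x ∈ y;
  hier_mono :
    ⊩ ⋀ a :in is_ordinal, ⋀ b :in is_ordinal, b ∈ a ⇒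
        ⋀ y, ⋀ z, R a y ⇒ R b z ⇒ sub_in univ z y
}.

Definition has_external_cumulative_hierarchy (M : V -> O) : Prop :=
  exists R, cumulative_hierarchy M R.

Definition almost_universal (M : V -> O) : Prop :=
  ⊩ ⋀ x, (⋀ z, z ∈ x ⇒ M z) ⇒ ⋁ y :in M, sub_in univ x y.

(* q = {a, b} *)
Definition is_pair q a b : O := ⋀ r, r ∈ q ⇔ r ≈ a ⊔ r ≈ b.

(* p = <a, b> = {{a}, {a, b}} *)
Definition is_opair p a b : O := ⋀ q, q ∈ p ⇔ is_pair q a a ⊔ is_pair q a b.

(* p = <a, b, c> = <a, <b, c>> *)
Definition is_otriple p a b c : O := ⋁ q, is_opair q b c ⊓ is_opair p a q.

(* <a, b> ∈ x *)
Definition opair_mem a b x : O := ⋁ p, is_opair p a b ⊓ p ∈ x.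

Variant fund_op :=
  | Op_pair | Op_bigcap | Op_union | Op_diff | Op_prod | Op_imp | Op_sections
  | Op_dom | Op_ran | Op_triple_right | Op_triple_mid | Op_eq | Op_mem.

(* The truth value of t ∈ F(x, y), for F a fundamental operation.             *)
Definition op_val (F : fund_op) x y (t : V) : O :=
  match F with
  | Op_pair => (* {x, y} *)
      t ≈ x ⊔ t ≈ y
  | Op_bigcap => (* x ∩ ⋂y, which is x when y is empty *)
      t ∈ x ⊓ ⋀ z, z ∈ y ⇒ t ∈ z
  | Op_union => (* ⋃x *)
      ⋁ z, z ∈ x ⊓ t ∈ z
  | Op_diff => (* x \ y *)
      t ∈ x ⊓ ∼ (t ∈ y)
  | Op_prod => (* x × y *)
      ⋁ u, ⋁ v, u ∈ x ⊓ v ∈ y ⊓ is_opair t u v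
  | Op_imp => (* x ∩ {z : y an ordered pair ∧ (z ∈ 1st y → z ∈ 2nd y)} *)
      t ∈ x ⊓ ⋁ a, ⋁ b, is_opair y a b ⊓ (t ∈ a ⇒ t ∈ b)
  | Op_sections => (* {{u : <z, u> ∈ x} : z ∈ y} *)
      ⋁ z, z ∈ y ⊓ ⋀ u, u ∈ t ⇔ opair_mem z u x
  | Op_dom => (* dom x *)
      ⋁ z, z ∈ x ⊓ ⋁ b, is_opair z t b
  | Op_ran => (* ran x *)
      ⋁ z, z ∈ x ⊓ ⋁ a, is_opair z a t
  | Op_triple_right => (* {<u, v, w> : <u, v> ∈ x ∧ w ∈ y} *)
      ⋁ u, ⋁ v, ⋁ w, opair_mem u v x ⊓ w ∈ y ⊓ is_otriple t u v w
  | Op_triple_mid => (* {<u, w, v> : <u, v> ∈ x ∧ w ∈ y} *)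
      ⋁ u, ⋁ v, ⋁ w, opair_mem u v x ⊓ w ∈ y ⊓ is_otriple t u w v
  | Op_eq => (* {<v, u> ∈ y × x : u = v} *)
      ⋁ v, ⋁ u, v ∈ y ⊓ u ∈ x ⊓ is_opair t v u ⊓ u ≈ v
  | Op_mem => (* {<v, u> ∈ y × x : u ∈ v} *)
      ⋁ v, ⋁ u, v ∈ y ⊓ u ∈ x ⊓ is_opair t v u ⊓ u ∈ v
  end.

Definition closed_fundamental (M : V -> O) : Prop :=
  forall F : fund_op,
    ⊩ ⋀ x :in M, ⋀ y :in M, ⋁ w :in M, ⋀ t, t ∈ w ⇔ op_val F x y t.

End SetTheory.

Arguments univ {O} V _.

(* Main.v *)
Require Import Defs.
From mathcomp Require Import all_boot.
From Stdlib Require Import FunctionalExtensionality.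

(* Almost universality follows from the hierarchy alone: if x ⊆ M, Collection *)
(* gives a set of ordinals a whose M_a cover x, and M_b contains x for b the  *)
(* union of the successors of these a.  If M is a model of IZF, each          *)
(* fundamental operation has an absolute definition and a bound in M, hence   *)
(* a value in M by Separation in M.                                           *)
(*   Conversely, the main point is full Separation in M.  By induction on phi *)
(* with n free variables, {<x_0, <x_1, ... <x_(n-1), ∅>>> : x_i ∈ X_i, phi^M} *)
(* is in M for all X_i in M: implication is the operation Op_imp, ∃ is a      *)
(* range and ∀ an intersection of sections, once the quantified variable is   *)
(* bounded.  Classically this uses reflection; here, one bounds it by         *)
(* collecting in V one value for each of the subsets of the product of the    *)
(* X_i that it defines, which treats ∃ and ∀ alike and needs no negation.     *)

(** Truth values are handled as in Kripke semantics: [le s p] says that p holds at the stage s, and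
    arguments are natural deductions at a stage that decreases whenever an assumption is made or a
    witness is named.

    A transitive model M of IZF contains the values of the operations because they are defined by
    formulas whose quantifiers are bounded by members or by coordinates of ordered pairs. Such
    formulas mean the same in M and in V ([Dfn_ex], [Dfn_all]), and [model_op] separates each value,
    inside M, from a bound built there with products, power sets and unions.

    Conversely, [good_sat] shows that for every formula the coded tuples satisfying it in M, with
    coordinates in given elements of M, form an element of M; [quantifier_bound] supplies the bounds
    for its quantifier steps. Fixing the parameters by singletons and taking a domain gives
    Separation in M ([M_sat_separation]). Power set, infinity and collection then share one pattern:
    form a set in V, intersect it with M, cover the result by an element of M using almost
    universality, and where equality is required cut the cover back by Separation in M. The schemes
    of V may be used for this because satisfaction in a definable M is itself definable in V
    ([Dfn_sat]). Extensionality and set induction pass from V to M, and pairs and unions are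
    operations. *)

Set Implicit Arguments.
Unset Strict Implicit.
Unset Printing Implicit Defensive.

Local Open Scope truth_scope.

(** * Reasoning at a stage of a complete Heyting algebra *)

Section Logic.

Variable O : cHeyting.
Implicit Types p q r s : O.

Lemma and_i s p q : le s p -> le s q -> le s (p ⊓ q).
Proof. by move=> *; apply/le_conj. Qed.

Lemma and_e s p q : le s (p ⊓ q) -> le s p /\ le s q.
Proof. by move/le_conj. Qed.

Lemma and_l s p q : le s (p ⊓ q) -> le s p.
Proof. by case/and_e. Qed.

Lemma and_r s p q : le s (p ⊓ q) -> le s q.
Proof. by case/and_e. Qed.

(** It is enough to test the stage [s ⊓ p], the largest one below s at which p holds. *)
Lemma imp_i s p q : (forall s', le s' s -> le s' p -> le s' q) -> le s (p ⇒ q).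
Proof.
move=> H; apply/le_impl; have [h1 h2] := and_e (le_refl (s ⊓ p)); exact: H.
Qed.

Lemma imp_e s p q : le s (p ⇒ q) -> le s p -> le s q.
Proof. by move=> /le_impl H Hp; apply: le_trans H; apply: and_i (le_refl _) Hp. Qed.

Lemma all_i s (I : Type) (F : I -> O) : (forall i, le s (F i)) -> le s (inf F).
Proof. by move=> *; apply/le_inf. Qed.

Lemma all_e s (I : Type) (F : I -> O) : le s (inf F) -> forall i, le s (F i).
Proof. by move/le_inf. Qed.

Lemma ex_i (I : Type) (i : I) s (F : I -> O) : le s (F i) -> le s (sup F).
Proof.
move=> H; apply: le_trans H _; by have /sup_le := le_refl (sup F).
Qed.

(** A supremum that holds at s need not have a witness at s itself. Moving s into the goal as
    [s ⇒ q] lets the supremum be bounded term by term: this is the infinite distributive law of a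
    Heyting algebra, and each witness is obtained at a smaller stage. *)
Lemma ex_e s (I : Type) (F : I -> O) q : le s (sup F) ->
  (forall s' i, le s' s -> le s' (F i) -> le s' q) -> le s q.
Proof.
move=> H K; suff /imp_e : le s (s ⇒ q) by apply; apply: le_refl.
apply: le_trans H _; apply/sup_le => i; apply: imp_i => s' l Hs.
exact: K Hs l.
Qed.

Lemma or_l s p q : le s p -> le s (p ⊔ q).
Proof. by move=> H; apply: le_trans H _; case/disj_le: (le_refl (p ⊔ q)). Qed.

Lemma or_r s p q : le s q -> le s (p ⊔ q).
Proof. by move=> H; apply: le_trans H _; case/disj_le: (le_refl (p ⊔ q)). Qed.

Lemma or_e s p q r : le s (p ⊔ q) ->
  (forall s', le s' s -> le s' p -> le s' r) ->
  (forall s', le s' s -> le s' q -> le s' r) -> le s r.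
Proof.
move=> H K L; suff /imp_e : le s (s ⇒ r) by apply; apply: le_refl.
apply: le_trans H _; apply/disj_le; split; apply: imp_i => s' l Hs.
  exact: K Hs l.
exact: L Hs l.
Qed.

Lemma bot_e s p : le s bot -> le s p.
Proof. by move=> H; apply: le_trans H (le_bot _). Qed.

Lemma iff_i s p q : (forall s', le s' s -> le s' p -> le s' q) ->
  (forall s', le s' s -> le s' q -> le s' p) -> le s (p ⇔ q).
Proof. by move=> H K; apply: and_i; apply: imp_i. Qed.

Lemma iff_l s p q : le s (p ⇔ q) -> le s p -> le s q.
Proof. by move=> /and_l; apply: imp_e. Qed.

Lemma iff_r s p q : le s (p ⇔ q) -> le s q -> le s p.
Proof. by move=> /and_r; apply: imp_e. Qed.

Lemma iff_refl s p : le s (p ⇔ p).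
Proof. by apply: iff_i. Qed.

Lemma allin_i s (I : Type) (D F : I -> O) :
  (forall s' x, le s' s -> le s' (D x) -> le s' (F x)) -> le s (⋀ x :in D, F x).
Proof. by move=> H; apply: all_i => x; apply: imp_i => s'; apply: H. Qed.

Lemma allin_e s (I : Type) (D F : I -> O) :
  le s (⋀ x :in D, F x) -> forall x, le s (D x) -> le s (F x).
Proof. by move=> /all_e H x; apply: imp_e. Qed.

Lemma exin_i (I : Type) (x : I) s (D F : I -> O) :
  le s (D x) -> le s (F x) -> le s (⋁ x :in D, F x).
Proof. by move=> *; apply: (ex_i (i := x)); apply: and_i. Qed.

End Logic.

(* A hypothesis that holds at a stage holds at every smaller one: given
   l : le s' s, transport the whole context to s' and forget s. *)
Ltac low l :=
  lazymatch type of l with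
  | le ?s' ?s =>
    repeat match goal with
    | H : le s _ |- _ =>
        let K := fresh "K" in pose proof (le_trans l H) as K; clear H; rename K into H
    | H : forall _, le s _ |- _ =>
        let K := fresh "K" in pose proof (fun x => le_trans l (H x)) as K;
        clear H; rename K into H; cbv beta in H
    end;
    try (clear l; clear s; rename s' into s)
  end.

(** These tactics perform one rule of natural deduction and then move the context to the new stage,
    again called s, so that scripts read like proofs at a fixed stage. *)
Ltac iimp :=
  let s' := fresh "s" in let l := fresh "l" in let h := fresh "h" in
  apply: imp_i; intros s' l h; low l; move: h.
Ltac iallin :=
  let s' := fresh "s" in let x := fresh "x" in let l := fresh "l" in let h := fresh "h" in
  apply: allin_i; intros s' x l h; low l; move: x h.
Ltac iiff :=
  apply: iff_i;
  (let s' := fresh "s" in let l := fresh "l" in let h := fresh "h" in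
   intros s' l h; low l; move: h).
Tactic Notation "iex" constr(H) :=
  apply: (ex_e H); try clear H;
  (let s' := fresh "s" in let x := fresh "x" in let l := fresh "l" in let h := fresh "h" in
   intros s' x l h; low l; move: x h).
Tactic Notation "ior" constr(H) :=
  apply: (or_e H); try clear H;
  (let s' := fresh "s" in let l := fresh "l" in let h := fresh "h" in
   intros s' l h; low l; move: h).

(** * Equality in a structure and its compatibility with satisfaction *)

Section Structure.

Variables (O : cHeyting) (V : structure O).
Implicit Types (s : O) (x y z a b : V).

Lemma eqv_refl s x : le s (x ≈ x).
Proof. exact: le_trans (le_top _) (eq_val_refl _). Qed.

Lemma eqv_sym s x y : le s (x ≈ y) -> le s (y ≈ x).
Proof. by move=> H; apply: le_trans H (eq_val_sym _ _). Qed.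

Lemma eqv_trans s x y z : le s (x ≈ y) -> le s (y ≈ z) -> le s (x ≈ z).
Proof. by move=> H K; apply: le_trans (and_i H K) (eq_val_trans _ _ _). Qed.

Lemma mem_congr s x x' y y' :
  le s (x ≈ x') -> le s (y ≈ y') -> le s (x ∈ y) -> le s (x' ∈ y').
Proof.
by move=> H K L; apply: le_trans (and_i H (and_i K L)) (mem_val_congr _ _ _ _).
Qed.

Lemma mem_l s x x' y : le s (x ≈ x') -> le s (x ∈ y) -> le s (x' ∈ y).
Proof. by move=> H; apply: mem_congr H (eqv_refl _ _). Qed.

Lemma mem_r s x y y' : le s (y ≈ y') -> le s (x ∈ y) -> le s (x ∈ y').
Proof. exact: mem_congr (eqv_refl _ _). Qed.

Lemma scons0 n (x : V) (e : 'I_n -> V) : scons x e ord0 = x.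
Proof. by rewrite /scons unlift_none. Qed.

Lemma sconsS n (x : V) (e : 'I_n -> V) i : scons x e (lift ord0 i) = e i.
Proof. by rewrite /scons liftK. Qed.

Lemma scons_eta n (e : 'I_n.+1 -> V) :
  scons (e ord0) (fun i => e (lift ord0 i)) = e.
Proof.
by apply: functional_extensionality => i; rewrite /scons; case: unliftP => [j|] ->.
Qed.

Definition congruent n (P : ('I_n -> V) -> O) :=
  forall s e e', (forall i, le s (e i ≈ e' i)) -> le s (P e) -> le s (P e').

(** A class is any function to O, and ≈ is not Rocq equality, so extensionality of a class has to be
    stated. *)
Definition respects (D : V -> O) :=
  forall s x y, le s (x ≈ y) -> le s (D x) -> le s (D y).

Lemma respects_univ : respects (univ V).
Proof. by move=> *; apply: le_top. Qed.

Lemma sat_congr (D : V -> O) n (phi : form n) : respects D -> congruent (sat D phi).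
Proof.
move=> RD; elim: phi => {n} [n i j|n i j|n|n f IHf g IHg|n f IHf g IHg
    |n f IHf g IHg|n f IHf|n f IHf] s e e' He /=.
- exact: mem_congr.
- by move=> H; apply: eqv_trans (eqv_trans (eqv_sym (He i)) H) (He j).
- by [].
- by case/and_e=> [H K]; apply: and_i; [apply: IHf H | apply: IHg K].
- by move=> H; ior H => H; [apply/or_l/(IHf _ e)|apply/or_r/(IHg _ e)].
- move=> H; iimp => K; apply: (IHg _ e) => //; apply: imp_e H _.
  by apply: (IHf _ e') => // i; apply: eqv_sym.
- move=> H; iallin => x Hx; have := allin_e H Hx; apply: IHf => i.
  by rewrite /scons; case: unliftP => [j|] _ //; apply: eqv_refl.
- move=> H; iex H => x /and_e[Hx Kx]; apply: (exin_i Hx); move: Kx.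
  apply: IHf => i; by rewrite /scons; case: unliftP => [j|] _ //; apply: eqv_refl.
Qed.

End Structure.

(** * Definability with parameters *)

Fixpoint ren n m (g : 'I_n -> 'I_m) (phi : form n) : form m :=
  match phi in form n return ('I_n -> 'I_m) -> form m with
  | Fmem n i j => fun g => Fmem (g i) (g j)
  | Feq n i j => fun g => Feq (g i) (g j)
  | Fbot n => fun g => Fbot m
  | Fand n a b => fun g => Fand (ren g a) (ren g b)
  | For n a b => fun g => For (ren g a) (ren g b)
  | Fimp n a b => fun g => Fimp (ren g a) (ren g b)
  | Fall n a => fun g => Fall (ren (scons ord0 (fun i => lift ord0 (g i))) a)
  | Fex n a => fun g => Fex (ren (scons ord0 (fun i => lift ord0 (g i))) a)
  end g.

Section Definability.

Variables (O : cHeyting) (V : structure O) (D : V -> O).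
Implicit Types (s : O) (x y z a b : V) (e : nat -> V).

Lemma sat_ren n (phi : form n) m (g : 'I_n -> 'I_m) (e : 'I_m -> V) :
  sat D (ren g phi) e = sat D phi (fun i => e (g i)).
Proof.
have aux k l (h : 'I_k -> 'I_l) (u : 'I_l -> V) x :
    (fun i => scons x u (scons ord0 (fun i => lift ord0 (h i)) i)) =
    scons x (fun i => u (h i)).
  apply: functional_extensionality => i; rewrite {2 3}/scons.
  by case: unliftP => [j|] _; rewrite ?sconsS ?scons0.
elim: phi m g e => {n} [n i j|n i j|n|n f IHf h IHh|n f IHf h IHh
    |n f IHf h IHh|n f IHf|n f IHf] m g e //=; rewrite ?IHf ?IHh //.
- by congr inf; apply: functional_extensionality => x; rewrite IHf aux.
- by congr sup; apply: functional_extensionality => x; rewrite IHf aux.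
Qed.

(* [f] says which free variables of a formula are coordinates of e and which   *)
(* are parameters; the parameters need to belong to D at the current stage only. *)
Definition assign N (f : 'I_N -> nat + V) e (i : 'I_N) : V :=
  match f i with inl k => e k | inr c => c end.

Definition params_ok s N (f : 'I_N -> nat + V) :=
  forall i, le s (match f i with inl _ => top | inr c => D c end).

(** P takes an infinite environment, so that predicates combine without matching their numbers of
    variables, with coordinate 0 as the innermost bound variable. The equivalence is required only
    below s and for environments in D: there, quantifiers over V can agree with the quantifiers over
    D of the relativized formula. *)
Definition Dfn s (P : (nat -> V) -> O) := exists N (phi : form N) f,
  params_ok s f /\
  forall s' e, le s' s -> (forall k, le s' (D (e k))) ->
    le s' (P e ⇔ sat D phi (assign f e)).

Inductive term s : ((nat -> V) -> V) -> Prop :=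
| term_var k : term s (fun e => e k)
| term_cst c : le s (D c) -> term s (fun _ => c).

Lemma term_in s t s' e : term s t -> le s' s ->
  (forall k, le s' (D (e k))) -> le s' (D (t e)).
Proof. by case=> [k|c Hc] l He //; apply: le_trans l Hc. Qed.

Lemma term_shift s t : term s t -> term s (fun e => t (fun k => e k.+1)).
Proof. by case=> [k|c Hc]; [apply: term_var k.+1|apply: term_cst]. Qed.

Lemma Dfn_ext s P Q : Dfn s Q ->
  (forall s' e, le s' s -> (forall k, le s' (D (e k))) -> le s' (P e ⇔ Q e)) ->
  Dfn s P.
Proof.
move=> [N [phi [f [Hf H]]]] PQ; exists N, phi, f; split=> // s' e l He.
move: (PQ _ _ l He) (H _ _ l He) => h1 h2.
by iiff => K; [apply/(iff_l h2)/(iff_l h1)|apply/(iff_r h1)/(iff_r h2)].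
Qed.

Lemma Dfn_term2 s t u (R : forall n, 'I_n -> 'I_n -> form n) r :
  (forall n i j (v : 'I_n -> V), sat D (R n i j) v = r (v i) (v j)) ->
  term s t -> term s u -> Dfn s (fun e => r (t e) (u e)).
Proof.
move=> Rr Ht Hu.
have aux v : term s v -> exists w : nat + V,
    le s (match w with inl _ => top | inr c => D c end) /\
    forall e, v e = match w with inl k => e k | inr c => c end.
  by case=> [k|c Hc]; [exists (inl k)|exists (inr c)]; split=> //; apply: le_top.
have [a [Ha Ea]] := aux _ Ht; have [b [Hb Eb]] := aux _ Hu.
exists 2, (R 2 ord0 (lift ord0 ord0)), (fun i => if i == ord0 then a else b); split.
  by move=> i; case: eqP.
by move=> s' e l He; rewrite Rr Ea Eb; apply: iff_refl.
Qed.

Lemma Dfn_mem s t u : term s t -> term s u -> Dfn s (fun e => t e ∈ u e).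
Proof. exact: (@Dfn_term2 s t u Fmem (fun x y => x ∈ y)). Qed.

Lemma Dfn_eq s t u : term s t -> term s u -> Dfn s (fun e => t e ≈ u e).
Proof. exact: (@Dfn_term2 s t u Feq (fun x y => x ≈ y)). Qed.

Lemma Dfn_bot s : Dfn s (fun _ => bot).
Proof.
exists 0, (Fbot 0), (fun _ => inl 0); split; first by move=> i; apply: le_top.
by move=> *; apply: iff_refl.
Qed.

(** The two formulas are renamed into disjoint blocks of [N + M] variables, so that one assignment
    serves both. *)
Lemma Dfn_merge s P Q : Dfn s P -> Dfn s Q -> exists N (phi psi : form N) f,
  params_ok s f /\
  forall s' e, le s' s -> (forall k, le s' (D (e k))) ->
    le s' (P e ⇔ sat D phi (assign f e)) /\
    le s' (Q e ⇔ sat D psi (assign f e)).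
Proof.
move=> [N [phi [f [Hf Kf]]]] [M [psi [g [Hg Kg]]]].
exists (N + M)%N, (ren (fun i => lshift M i) phi), (ren (fun i => rshift N i) psi).
exists (fun i => match split i with inl j => f j | inr j => g j end); split.
  by move=> i; case: (split i).
move=> s' e l He; rewrite !sat_ren.
rewrite (_ : (fun i => _) = assign f e).
  rewrite (_ : (fun i => _) = assign g e); first by split; [apply: Kf|apply: Kg].
  apply: functional_extensionality => i; rewrite /assign.
  by have := unsplitK (inr _ i : 'I_N + 'I_M) => /= ->.
apply: functional_extensionality => i; rewrite /assign.
by have := unsplitK (inl _ i : 'I_N + 'I_M) => /= ->.
Qed.

Lemma Dfn_and s P Q : Dfn s P -> Dfn s Q -> Dfn s (fun e => P e ⊓ Q e).
Proof.
move=> HP HQ; have [N [phi [psi [f [Hf H]]]]] := Dfn_merge HP HQ.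
exists N, (Fand phi psi), f; split=> // s' e l He; have [K L] := H _ _ l He.
by iiff => /= /and_e[h1 h2]; apply: and_i;
  [apply: iff_l K _|apply: iff_l L _|apply: iff_r K _|apply: iff_r L _].
Qed.

Lemma Dfn_or s P Q : Dfn s P -> Dfn s Q -> Dfn s (fun e => P e ⊔ Q e).
Proof.
move=> HP HQ; have [N [phi [psi [f [Hf H]]]]] := Dfn_merge HP HQ.
exists N, (For phi psi), f; split=> // s' e l He; have [K L] := H _ _ l He.
iiff => /= h; ior h => h; [apply/or_l|apply/or_r|apply/or_l|apply/or_r];
  [apply: iff_l K _|apply: iff_l L _|apply: iff_r K _|apply: iff_r L _] => //.
Qed.

Lemma Dfn_imp s P Q : Dfn s P -> Dfn s Q -> Dfn s (fun e => P e ⇒ Q e).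
Proof.
move=> HP HQ; have [N [phi [psi [f [Hf H]]]]] := Dfn_merge HP HQ.
exists N, (Fimp phi psi), f; split=> // s' e l He; have [K L] := H _ _ l He.
iiff => /= h; iimp => h'.
  by apply/(iff_l L)/(imp_e h)/(iff_r K).
by apply/(iff_r L)/(imp_e h)/(iff_l K).
Qed.

Lemma Dfn_iff s P Q : Dfn s P -> Dfn s Q -> Dfn s (fun e => P e ⇔ Q e).
Proof. by move=> HP HQ; apply: Dfn_and; apply: Dfn_imp. Qed.

Lemma Dfn_top s : Dfn s (fun _ => top).
Proof.
apply: (Dfn_ext (Dfn_imp (Dfn_bot s) (Dfn_bot s))) => s' e l He.
by iiff => _; [iimp|apply: le_top].
Qed.

Definition ncons x e k : V := if k is k'.+1 then e k' else x.

Lemma ncons_in s x e : le s (D x) -> (forall k, le s (D (e k))) ->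
  forall k, le s (D (ncons x e k)).
Proof. by move=> Hx He []. Qed.

Lemma bind_formula s N (phi : form N) f : params_ok s f ->
  exists (phi' : form N.+1) f', params_ok s f' /\ forall x e,
    sat D phi' (scons x (assign f' e)) = sat D phi (assign f (ncons x e)).
Proof.
move=> Hf.
(* All variables standing for coordinate 0 are merged into the bound variable and the other
   coordinates go down by one. The value [0.-1 = 0] is a mere default: the variables that would
   receive it have been renamed to [ord0]. *)
exists (ren (fun i => if f i is inl 0 then ord0 else lift ord0 i) phi).
exists (fun i => match f i with inl k => inl k.-1 | inr c => inr c end); split.
  by move=> i; have := Hf i; case: (f i).
move=> x e; rewrite sat_ren; congr (sat D phi _).
apply: functional_extensionality => i; rewrite /assign.
by case Ef: (f i) => [[|k]|c]; rewrite ?scons0 ?sconsS ?Ef.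
Qed.

Lemma bind_formula2 s N (phi : form N) f : params_ok s f ->
  exists (phi' : form N.+2) f', params_ok s f' /\ forall x y e,
    sat D phi' (scons x (scons y (assign f' e))) =
    sat D phi (assign f (ncons x (ncons y e))).
Proof.
move=> Hf.
exists (ren (fun i => match f i with
  | inl 0 => ord0 | inl 1 => lift ord0 ord0 | _ => lift ord0 (lift ord0 i) end) phi).
exists (fun i => match f i with inl k => inl k.-2 | inr c => inr c end); split.
  by move=> i; have := Hf i; case: (f i).
move=> x y e; rewrite sat_ren; congr (sat D phi _).
apply: functional_extensionality => i; rewrite /assign.
by case Ef: (f i) => [[|[|k]]|c]; rewrite ?(scons0, sconsS) ?Ef.
Qed.

(** The quantifier on the left ranges over V, the one in the formula over D. They agree because the
    side condition puts every witness in D, which is how absoluteness of bounded formulas enters. *)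
Lemma Dfn_ex s (F : (nat -> V) -> V -> O) :
  Dfn s (fun e => F (fun k => e k.+1) (e 0)) ->
  (forall s' e x, le s' s -> (forall k, le s' (D (e k))) ->
     le s' (F e x) -> le s' (D x)) ->
  Dfn s (fun e => ⋁ x, F e x).
Proof.
move=> [N [phi [f [Hf H]]]] side; have [phi' [f' [Hf' E]]] := bind_formula phi Hf.
exists N, (Fex phi'), f'; split=> // s' e l He /=; iiff => h; iex h => x.
  move=> Hx; have Dx := side _ _ _ l He Hx; apply: (exin_i Dx); rewrite E.
  exact: iff_l (H _ (ncons x e) l (ncons_in Dx He)) Hx.
case/and_e=> Dx; rewrite E => Hx; apply: (ex_i (i := x)).
exact: iff_r (H _ (ncons x e) l (ncons_in Dx He)) Hx.
Qed.

Lemma Dfn_all s (F : (nat -> V) -> V -> O) :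
  Dfn s (fun e => F (fun k => e k.+1) (e 0)) ->
  (forall s' e x, le s' s -> (forall k, le s' (D (e k))) ->
     le s' (D x ⇒ F e x) -> le s' (F e x)) ->
  Dfn s (fun e => ⋀ x, F e x).
Proof.
move=> [N [phi [f [Hf H]]]] side; have [phi' [f' [Hf' E]]] := bind_formula phi Hf.
exists N, (Fall phi'), f'; split=> // s' e l He /=; iiff => h.
  iallin => x Dx; rewrite E.
  exact: iff_l (H _ (ncons x e) l (ncons_in Dx He)) (all_e h x).
apply: all_i => x; apply: side => //; iimp => Dx; move: (allin_e h Dx).
rewrite E; exact: iff_r (H _ (ncons x e) l (ncons_in Dx He)).
Qed.

Section Schemes.

(** This and the next two lemmas replace schemes indexed by formulas with statements about definable
    predicates at a stage, so that de Bruijn syntax does not appear in later arguments. *)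
Lemma Separation_Dfn : (forall n (phi : form n.+1), ⊩ Separation D phi) ->
  forall s (P : V -> O) a, Dfn s (fun e => P (e 0)) -> le s (D a) ->
  le s (⋁ b :in D, ⋀ x :in D, x ∈ b ⇔ x ∈ a ⊓ P x).
Proof.
move=> sep s P a [N [phi [f [Hf H]]]] Da.
have [phi' [f' [Hf' E]]] := bind_formula phi Hf.
(* The remaining coordinates must be filled with elements of D, and a is one at hand. *)
have Hx : le s (⋀ x :in D, P x ⇔ sat D phi' (scons x (assign f' (fun _ => a)))).
  apply: allin_i => s' x l Dx; rewrite E.
  by apply: (H s' (ncons x (fun _ => a)) l (ncons_in Dx _)) => k; apply: le_trans l Da.
have /allin_e K := le_trans (le_top s) (sep _ phi').
have Pe : le s (params_in D (assign f' (fun _ => a))).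
  by apply: all_i => i; have := Hf' i; rewrite /assign; case: (f' i).
have {K Pe}K := allin_e (K _ Pe) Da; move: K Hx Da; clear => K Hx Da.
iex K => b /and_e[Db Hb]; apply: (exin_i Db); iallin => x Dx.
have {}Hb := allin_e Hb Dx; have {}Hx := allin_e Hx Dx; iiff.
  by move/(iff_l Hb)/and_e=> [h1 h2]; apply: and_i => //; apply: iff_r Hx h2.
by move/and_e=> [h1 h2]; apply/(iff_r Hb)/and_i => //; apply: iff_l Hx h2.
Qed.

Lemma Collection_Dfn : (forall n (phi : form n.+2), ⊩ Collection D phi) ->
  forall s (P : V -> V -> O) a, Dfn s (fun e => P (e 0) (e 1)) -> le s (D a) ->
  le s (⋀ x :in D, x ∈ a ⇒ ⋁ y :in D, P x y) ->
  le s (⋁ b :in D, ⋀ x :in D, x ∈ a ⇒ ⋁ y :in D, y ∈ b ⊓ P x y).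
Proof.
move=> coll s P a [N [phi [f [Hf H]]]] Da Ha.
have [phi' [f' [Hf' E]]] := bind_formula2 phi Hf.
have Hx : le s (⋀ x :in D, ⋀ y :in D,
    P x y ⇔ sat D phi' (scons x (scons y (assign f' (fun _ => a))))).
  apply: allin_i => s1 x l Dx; apply: allin_i => s2 y l' Dy; rewrite E.
  have l2 := le_trans l' l.
  apply: (H s2 (ncons x (ncons y (fun _ => a))) l2 _).
  apply: (ncons_in (le_trans l' Dx)); apply: (ncons_in Dy) => _.
  exact: le_trans l2 Da.
have /allin_e K := le_trans (le_top s) (coll _ phi').
have Pe : le s (params_in D (assign f' (fun _ => a))).
  by apply: all_i => i; have := Hf' i; rewrite /assign; case: (f' i).
have {K Pe}K := allin_e (K _ Pe) Da; move: K Hx Ha Da; clear => K Hx Ha Da.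
have {K}K : le s (⋁ b :in D, ⋀ x :in D, x ∈ a ⇒ ⋁ y :in D,
    y ∈ b ⊓ sat D phi' (scons x (scons y (assign f' (fun _ => a))))).
  apply: (imp_e K); iallin => x Dx; iimp => xa.
  have {}K := imp_e (allin_e Ha Dx) xa; iex K => y /and_e[Dy Hy].
  by apply: (exin_i Dy); apply: iff_l (allin_e (allin_e Hx Dx) Dy) Hy.
iex K => b /and_e[Db Hb]; apply: (exin_i Db).
iallin => x Dx; iimp => xa.
have K := imp_e (allin_e Hb Dx) xa; iex K => y /and_e[Dy /and_e[yb Hy]].
by apply: (exin_i Dy); apply: (and_i yb); apply: iff_r (allin_e (allin_e Hx Dx) Dy) Hy.
Qed.

Lemma SetInduction_Dfn : (forall n (phi : form n.+1), ⊩ SetInduction D phi) ->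
  forall s (P : V -> O) a, Dfn s (fun e => P (e 0)) -> le s (D a) ->
  le s (⋀ b :in D, (⋀ x :in D, x ∈ b ⇒ P x) ⇒ P b) -> le s (P a).
Proof.
move=> ind s P a [N [phi [f [Hf H]]]] Da Ha.
have [phi' [f' [Hf' E]]] := bind_formula phi Hf.
have Hx : le s (⋀ x :in D, P x ⇔ sat D phi' (scons x (assign f' (fun _ => a)))).
  apply: allin_i => s' x l Dx; rewrite E.
  by apply: (H s' (ncons x (fun _ => a)) l (ncons_in Dx _)) => k; apply: le_trans l Da.
have /allin_e K := le_trans (le_top s) (ind _ phi').
have Pe : le s (params_in D (assign f' (fun _ => a))).
  by apply: all_i => i; have := Hf' i; rewrite /assign; case: (f' i).
have {K Pe}K := K _ Pe; move: K Hx Ha Da; clear => K Hx Ha Da.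
apply: (iff_r (allin_e Hx Da)); refine (allin_e (imp_e K _) Da).
iallin => b Db; iimp => Hb; apply: iff_l (allin_e Hx Db) _.
apply: (imp_e (allin_e Ha Db)); iallin => x Dx; iimp => xb.
by apply: iff_r (allin_e Hx Dx) _; apply: imp_e (allin_e Hb Dx) xb.
Qed.

End Schemes.

End Definability.

(** * Pairs and the schemes of IZF for definable classes *)

Section Classes.

Variables (O : cHeyting) (V : structure O) (D : V -> O).
Implicit Types (s : O) (x y z a b p q : V).

Lemma Dfn_subst s (P : V -> O) x y : respects D -> Dfn D s (fun e => P (e 0)) ->
  le s (D x) -> le s (x ≈ y) -> le s (P x) -> le s (P y).
Proof.
move=> RD [N [phi [f [Hf H]]]] Dx xy Px.
have Dy := RD _ _ _ xy Dx.
have Hx := H s (fun _ => x) (le_refl s) (fun _ => Dx).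
have Hy := H s (fun _ => y) (le_refl s) (fun _ => Dy).
apply: iff_r Hy _; apply: (sat_congr RD (e := assign f (fun _ => x))).
  by move=> i; rewrite /assign; case: (f i) => [k|c] //; apply: eqv_refl.
exact: iff_l Hx Px.
Qed.

(** If each side of the equivalence forces x into D, then quantifying over V or over D makes no
    difference. Descriptions of a set by its members have this shape. *)
Lemma Dfn_all_iff s (A B : (nat -> V) -> V -> O) :
  Dfn D s (fun e => A (fun k => e k.+1) (e 0)) ->
  Dfn D s (fun e => B (fun k => e k.+1) (e 0)) ->
  (forall s' e x, le s' s -> (forall k, le s' (D (e k))) -> le s' (A e x) -> le s' (D x)) ->
  (forall s' e x, le s' s -> (forall k, le s' (D (e k))) -> le s' (B e x) -> le s' (D x)) ->
  Dfn D s (fun e => ⋀ x, A e x ⇔ B e x).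
Proof.
move=> HA HB sA sB; apply: Dfn_all; first exact: Dfn_iff.
move=> s' e x l He H; iiff => K.
  by apply: (iff_l (imp_e H (sA _ _ _ l He K)) K).
by apply: (iff_r (imp_e H (sB _ _ _ l He K)) K).
Qed.

Lemma Dfn_all_in s (A B : (nat -> V) -> V -> O) :
  Dfn D s (fun e => A (fun k => e k.+1) (e 0)) ->
  Dfn D s (fun e => B (fun k => e k.+1) (e 0)) ->
  (forall s' e x, le s' s -> (forall k, le s' (D (e k))) -> le s' (A e x) -> le s' (D x)) ->
  Dfn D s (fun e => ⋀ x, A e x ⇒ B e x).
Proof.
move=> HA HB sA; apply: Dfn_all; first exact: Dfn_imp.
by move=> s' e x l He H; iimp => K; apply: (imp_e (imp_e H (sA _ _ _ l He K)) K).
Qed.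

Hypothesis D_trans : forall s x y, le s (D y) -> le s (x ∈ y) -> le s (D x).
Hypothesis D_resp : respects D.
Hypothesis D_pair : forall s q a b,
  le s (D a) -> le s (D b) -> le s (is_pair q a b) -> le s (D q).
Hypothesis pair_ex : forall s a b, le s (⋁ q, is_pair q a b).

Lemma mem_pair s q a b r : le s (is_pair q a b) -> le s (r ≈ a ⊔ r ≈ b) -> le s (r ∈ q).
Proof. by move/all_e/(_ r)/iff_r; apply. Qed.

Lemma mem_pair_l s q a b : le s (is_pair q a b) -> le s (a ∈ q).
Proof. by move=> H; apply: (mem_pair H); apply/or_l/eqv_refl. Qed.

Lemma mem_pair_r s q a b : le s (is_pair q a b) -> le s (b ∈ q).
Proof. by move=> H; apply: (mem_pair H); apply/or_r/eqv_refl. Qed.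

(** [is_opair] only says which sets would be members of p; that {a} really occurs in p requires that
    it exist. *)
Lemma opair_mem_l s p a b : le s (is_opair p a b) -> le s (⋁ q, q ∈ p ⊓ is_pair q a a).
Proof.
move=> H; have K := pair_ex s a a; iex K => q Hq; apply: (ex_i (i := q)).
by apply: and_i => //; apply: (iff_r (all_e H q)); apply: or_l.
Qed.

Lemma opair_mem_r s p a b : le s (is_opair p a b) -> le s (⋁ q, q ∈ p ⊓ is_pair q a b).
Proof.
move=> H; have K := pair_ex s a b; iex K => q Hq; apply: (ex_i (i := q)).
by apply: and_i => //; apply: (iff_r (all_e H q)); apply: or_r.
Qed.

Lemma D_opair_l s p a b : le s (D p) -> le s (is_opair p a b) -> le s (D a).
Proof.
move=> Dp H; have K := opair_mem_l H; iex K => q /and_e[qp Hq].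
exact: (D_trans (D_trans Dp qp) (mem_pair_l Hq)).
Qed.

Lemma D_opair_r s p a b : le s (D p) -> le s (is_opair p a b) -> le s (D b).
Proof.
move=> Dp H; have K := opair_mem_r H; iex K => q /and_e[qp Hq].
exact: (D_trans (D_trans Dp qp) (mem_pair_r Hq)).
Qed.

(** Being a pair is absolute: a member of q is in D by transitivity, and a set equal to a or b is in
    D because D respects ≈. *)
Lemma Dfn_is_pair s (q a b : (nat -> V) -> V) : term D s q -> term D s a -> term D s b ->
  Dfn D s (fun e => is_pair (q e) (a e) (b e)).
Proof.
move=> Tq Ta Tb; apply: Dfn_all_iff.
- by apply: Dfn_mem; [apply: term_var|apply: term_shift].
- by apply: Dfn_or; apply: Dfn_eq; (apply: term_shift || apply: term_var).
- move=> s' e x l He; exact: D_trans (term_in Tq l He).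
move=> s' e x l He K; have Ha := term_in Ta l He; have Hb := term_in Tb l He.
by ior K => K; apply: (D_resp (eqv_sym K)).
Qed.

Lemma Dfn_is_opair s (q a b : (nat -> V) -> V) : term D s q -> term D s a -> term D s b ->
  Dfn D s (fun e => is_opair (q e) (a e) (b e)).
Proof.
move=> Tq Ta Tb; apply: Dfn_all_iff.
- by apply: Dfn_mem; [apply: term_var|apply: term_shift].
- by apply: Dfn_or; apply: Dfn_is_pair; (apply: term_shift || apply: term_var).
- move=> s' e x l He; exact: D_trans (term_in Tq l He).
move=> s' e x l He K; have Ha := term_in Ta l He; have Hb := term_in Tb l He.
by ior K => K; apply: D_pair K.
Qed.

Lemma Dfn_opair_mem s (a b x : (nat -> V) -> V) : term D s a -> term D s b -> term D s x ->
  Dfn D s (fun e => opair_mem (a e) (b e) (x e)).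
Proof.
move=> Ta Tb Tx; apply: Dfn_ex.
- apply: Dfn_and; first by apply: Dfn_is_opair; (apply: term_shift || apply: term_var).
  by apply: Dfn_mem; (apply: term_shift || apply: term_var).
- by move=> s' e y l He /and_r; apply: D_trans (term_in Tx l He).
Qed.

Lemma Dfn_is_otriple s (p a b c : (nat -> V) -> V) : term D s p -> term D s a -> term D s b -> term D s c ->
  Dfn D s (fun e => is_otriple (p e) (a e) (b e) (c e)).
Proof.
move=> Tp Ta Tb Tc; apply: Dfn_ex.
- by apply: Dfn_and; apply: Dfn_is_opair; (apply: term_shift || apply: term_var).
- by move=> s' e y l He /and_r; apply: D_opair_r (term_in Tp l He).
Qed.

End Classes.

Ltac dterm :=
  cbv beta;
  first [ apply: term_var
        | apply: term_cst; first [ assumption | apply: le_top | idtac ] ].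

(** Definability is proved by following the outermost connective. Quantifiers are left to [vdfn1]
    and [mdfn1], whose side conditions are trivial over [univ V] but express boundedness over M. *)
Ltac dfn1 tac :=
  cbv beta;
  lazymatch goal with
  | |- Dfn _ _ (fun _ => is_pair _ _ _) => apply: Dfn_is_pair; tac
  | |- Dfn _ _ (fun _ => is_opair _ _ _) => apply: Dfn_is_opair; tac
  | |- Dfn _ _ (fun _ => opair_mem _ _ _) => apply: Dfn_opair_mem; tac
  | |- Dfn _ _ (fun _ => is_otriple _ _ _ _) => apply: Dfn_is_otriple; tac
  | |- Dfn _ _ (fun _ => mem_val _ _) => apply: Dfn_mem; dterm
  | |- Dfn _ _ (fun _ => eq_val _ _) => apply: Dfn_eq; dterm
  | |- Dfn _ _ (fun _ => bot) => apply: Dfn_bot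
  | |- Dfn _ _ (fun _ => top) => apply: Dfn_top
  | |- Dfn _ _ (fun _ => iff_val _ _) => apply: Dfn_iff
  | |- Dfn _ _ (fun _ => conj _ _) => apply: Dfn_and
  | |- Dfn _ _ (fun _ => disj _ _) => apply: Dfn_or
  | |- Dfn _ _ (fun _ => impl _ _) => apply: Dfn_imp
  end.

(** * The axioms of V for definable predicates *)

Section Universe.

Variables (O : cHeyting) (V : structure O).
Hypothesis V_IZF : model_IZF (univ V).
Implicit Types (s : O) (x y z a b p q : V).

Lemma V_ext s x y : le s (⋀ z, z ∈ x ⇔ z ∈ y) -> le s (x ≈ y).
Proof.
move=> H; have /allin_e/(_ x (le_top _))/allin_e/(_ y (le_top _)) K :=
  le_trans (le_top s) (izf_extensionality V_IZF).
by apply: (imp_e K); apply: all_i => z; iimp => _; apply: (all_e H).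
Qed.

Lemma V_ext_in s x y (P : V -> O) : le s (⋀ z, z ∈ x ⇔ P z) ->
  le s (⋀ z, z ∈ y ⇔ P z) -> le s (x ≈ y).
Proof.
move=> H K; apply: V_ext; apply: all_i => z; iiff => L.
  by apply: (iff_r (all_e K z)); apply: (iff_l (all_e H z)).
by apply: (iff_r (all_e H z)); apply: (iff_l (all_e K z)).
Qed.

Lemma V_pair s a b : le s (⋁ q, is_pair q a b).
Proof.
have /allin_e/(_ a (le_top _))/allin_e/(_ b (le_top _)) K :=
  le_trans (le_top s) (izf_pairing V_IZF).
iex K => q /and_r H; apply: (ex_i (i := q)); apply: all_i => r.
by apply: (allin_e H); apply: le_top.
Qed.

Lemma V_union s a : le s (⋁ u, ⋀ z, z ∈ u ⇔ ⋁ y, y ∈ a ⊓ z ∈ y).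
Proof.
have /allin_e/(_ a (le_top _)) K := le_trans (le_top s) (izf_unions V_IZF).
iex K => q /and_r H; apply: (ex_i (i := q)); apply: all_i => r.
have {}H := allin_e H (le_top _ : le _ (univ V r)); iiff => K.
  by move: (iff_l H K) => {}H; iex H => y /and_r; apply: (ex_i (i := y)).
by apply: (iff_r H); iex K => y Hy; apply: (exin_i (x := y) (le_top _)).
Qed.

Lemma V_power s a : le s (⋁ u, ⋀ z, z ∈ u ⇔ ⋀ y, y ∈ z ⇒ y ∈ a).
Proof.
have /allin_e/(_ a (le_top _)) K := le_trans (le_top s) (izf_power_set V_IZF).
iex K => q /and_r H; apply: (ex_i (i := q)); apply: all_i => r.
have {}H := allin_e H (le_top _ : le _ (univ V r)); iiff => K.
  by apply: all_i => y; apply: (allin_e (iff_l H K)); apply: le_top.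
by apply: (iff_r H); iallin => y _; exact: all_e K y.
Qed.

Lemma V_sep s (P : V -> O) a : Dfn (univ V) s (fun e => P (e 0)) ->
  le s (⋁ b, ⋀ x, x ∈ b ⇔ x ∈ a ⊓ P x).
Proof.
move=> HP; have := Separation_Dfn (izf_separation V_IZF) HP (le_top _ : le s (univ V a)).
move=> H; iex H => b /and_r H; apply: (ex_i (i := b)); apply: all_i => x.
by apply: (allin_e H); apply: le_top.
Qed.

Lemma V_coll s (P : V -> V -> O) a : Dfn (univ V) s (fun e => P (e 0) (e 1)) ->
  le s (⋀ x, x ∈ a ⇒ ⋁ y, P x y) ->
  le s (⋁ b, ⋀ x, x ∈ a ⇒ ⋁ y, y ∈ b ⊓ P x y).
Proof.
move=> HP Ha.
have := Collection_Dfn (izf_collection V_IZF) HP (le_top _ : le s (univ V a)).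
have K : le s (⋀ x :in univ V, x ∈ a ⇒ ⋁ y :in univ V, P x y).
  iallin => x _; iimp => xa; have K := imp_e (all_e Ha x) xa.
  by iex K => y Hy; apply: (exin_i _ Hy); apply: le_top.
move/(_ K) => {K Ha HP} H; iex H => b /and_r H; apply: (ex_i (i := b)).
apply: all_i => x; iimp => xa; have {}H := imp_e (allin_e H (le_top _)) xa.
by iex H => y /and_r; apply: (ex_i (i := y)).
Qed.

Lemma V_ind s (P : V -> O) a : Dfn (univ V) s (fun e => P (e 0)) ->
  le s (⋀ b, (⋀ x, x ∈ b ⇒ P x) ⇒ P b) -> le s (P a).
Proof.
move=> HP H; apply: (SetInduction_Dfn (izf_set_induction V_IZF) HP); first exact: le_top.
iallin => b _; iimp => K; apply: (imp_e (all_e H b)).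
by apply: all_i => x; apply: (allin_e K); apply: le_top.
Qed.

Lemma V_subst s (P : V -> O) x y : Dfn (univ V) s (fun e => P (e 0)) ->
  le s (x ≈ y) -> le s (P x) -> le s (P y).
Proof. by move=> HP; apply: (Dfn_subst (@respects_univ _ V) HP); apply: le_top. Qed.

End Universe.

(** Over [univ V] every side condition reduces to [le_top]; the last branch removes the premise
    [univ V x] in the condition of [Dfn_all]. *)
Ltac vfacts := first
  [ dterm
  | move=> *; exact: le_top
  | exact: respects_univ
  | exact: V_pair
  | let h := fresh in move=> ? ? ? ? ? h; apply: (imp_e h); exact: le_top ].
Ltac vdfn1 :=
  cbv beta;
  lazymatch goal with
  | |- Dfn _ _ (fun _ => sup _) => apply: Dfn_ex; [|vfacts]
  | |- Dfn _ _ (fun _ => inf _) => apply: Dfn_all; [|vfacts]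
  | |- Dfn _ _ (fun _ => univ _ _) => apply: Dfn_top
  | |- Dfn _ _ (fun _ => sub_in _ _ _) => rewrite /sub_in
  | |- Dfn _ _ (fun _ => transitive_set _) => rewrite /transitive_set
  | |- Dfn _ _ (fun _ => is_ordinal _) => rewrite /is_ordinal
  | H : forall s t, term (univ _) s t -> Dfn _ s (fun e => ?M (t e)) |- Dfn _ _ (fun _ => ?M _) =>
      apply: H; dterm
  | H : forall s t u, term (univ _) s t -> term (univ _) s u -> Dfn _ s (fun e => ?M (t e) (u e)) |- Dfn _ _ (fun _ => ?M _ _) =>
      apply: H; dterm
  | |- _ => dfn1 vfacts
  end.
Ltac vdfn := repeat vdfn1.

(** * Kuratowski pairs *)

Section OrderedPairs.
Variables (O : cHeyting) (V : structure O).
Hypothesis V_IZF : model_IZF (univ V).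
Implicit Types (s : O) (x y z a b p q : V).

Lemma is_pair_unique s q q' a b : le s (is_pair q a b) -> le s (is_pair q' a b) -> le s (q ≈ q').
Proof. exact: V_ext_in. Qed.

Lemma opair_congr s p a b p' a' b' : le s (is_opair p a b) ->
  le s (p ≈ p') -> le s (a ≈ a') -> le s (b ≈ b') -> le s (is_opair p' a' b').
Proof.
move=> H hp ha hb.
apply: (V_subst (P := fun p => is_opair p a' b')) hp _; first by vdfn.
apply: (V_subst (P := fun a => is_opair p a b')) ha _; first by vdfn.
by apply: (V_subst (P := fun b => is_opair p a b)) hb H; vdfn.
Qed.

Lemma opair_ex s a b : le s (⋁ p, is_opair p a b).
Proof.
have K := V_pair V_IZF s a a; iex K => q Hq; have K := V_pair V_IZF s a b; iex K => r Hr.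
have K := V_pair V_IZF s q r; iex K => p Hp; apply: (ex_i (i := p)).
apply: all_i => u; iiff => K.
  have {}K := iff_l (all_e Hp u) K; ior K => K; [apply: or_l|apply: or_r].
    by apply: (V_subst (P := fun u => is_pair u a a)) (eqv_sym K) Hq; vdfn.
  by apply: (V_subst (P := fun u => is_pair u a b)) (eqv_sym K) Hr; vdfn.
apply: (iff_r (all_e Hp u)); ior K => K; [apply: or_l|apply: or_r].
  exact: is_pair_unique K Hq.
exact: is_pair_unique K Hr.
Qed.

(** The argument never decides whether a equals b. Since {a} is one of {a'}, {a', b'}, it contains
    a', so a' = a. Since {a, b} is one of them, b is a' or b', and symmetrically b' is a or b; in
    the one case left open, b = a' = a = b'. *)
Lemma opair_inj s p a b a' b' : le s (is_opair p a b) -> le s (is_opair p a' b') ->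
  le s (a ≈ a') /\ le s (b ≈ b').
Proof.
have fst_le s1 p1 a1 b1 a2 b2 : le s1 (is_opair p1 a1 b1) -> le s1 (is_opair p1 a2 b2) ->
    le s1 (a2 ≈ a1).
  move=> H K; have L := opair_mem_l (V_pair V_IZF) H; iex L => q /and_e[qp Hq].
  have aux r : le s1 (is_pair q a2 r) -> le s1 (a2 ≈ a1).
    move=> Hq'; have := iff_l (all_e Hq a2) (mem_pair_l Hq') => L.
    by ior L.
  have L := iff_l (all_e K q) qp.
  by ior L => L; have L' := iff_l (all_e Hq a2) (mem_pair_l L); ior L'.
have snd_le s1 p1 a1 b1 a2 b2 : le s1 (is_opair p1 a1 b1) -> le s1 (is_opair p1 a2 b2) ->
    le s1 (b1 ≈ a2 ⊔ b1 ≈ b2).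
  move=> H K; have L := opair_mem_r (V_pair V_IZF) H; iex L => q /and_e[qp Hq].
  have L := iff_l (all_e K q) qp.
  ior L => L; have := iff_l (all_e L b1) (mem_pair_r Hq) => // {}L.
  by ior L => L; apply: or_l.
move=> H K; have Ha := eqv_sym (fst_le _ _ _ _ _ _ H K); split=> //.
have L1 := snd_le _ _ _ _ _ _ H K; have L2 := snd_le _ _ _ _ _ _ K H.
ior L1 => // L1; ior L2 => L2; last exact: eqv_sym.
exact: eqv_trans L1 (eqv_trans (eqv_sym Ha) (eqv_sym L2)).
Qed.

End OrderedPairs.

(** * Ordinals and the external hierarchy *)

Section Hierarchy.

Variables (O : cHeyting) (V : structure O).
Implicit Types (s : O) (x y z a b p q : V).

Lemma term_params s (D : V -> O) t : term D s t -> exists f : nat + V,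
  le s (match f with inl _ => top | inr c => D c end) /\
  forall e, t e = match f with inl k => e k | inr c => c end.
Proof.
by case=> [k|c Hc]; [exists (inl k)|exists (inr c)]; split=> //; apply: le_top.
Qed.

Lemma Dfn_class (M : V -> O) : definable_class M ->
  forall s t, term (univ V) s t -> Dfn (univ V) s (fun e => M (t e)).
Proof.
move=> [n [phi [v Mv]]] s t /term_params[f [Hf Ef]].
exists n.+1, phi, (scons f (fun i => inr (v i))).
split=> [i|s' e l _]; first by rewrite /scons; case: unliftP => [j|] _ //; apply: le_top.
rewrite Mv (_ : scons _ _ = assign (scons f (fun i => inr (v i))) e); first exact: iff_refl.
apply: functional_extensionality => i; rewrite /scons /assign.
by case: unliftP => [j|] _.
Qed.

Lemma Dfn_rel (R : V -> V -> O) : definable_rel R ->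
  forall s t u, term (univ V) s t -> term (univ V) s u ->
  Dfn (univ V) s (fun e => R (t e) (u e)).
Proof.
move=> [n [phi [v Rv]]] s t u /term_params[f [Hf Ef]] /term_params[g [Hg Eg]].
set h := scons f (scons g (fun i => inr (v i))); exists n.+2, phi, h.
split=> [i|s' e l _].
  rewrite /h /scons; case: unliftP => [j|] _ //; case: unliftP => [k|] _ //.
  exact: le_top.
rewrite Rv (_ : scons _ _ = assign h e); first exact: iff_refl.
apply: functional_extensionality => i; rewrite /h /scons /assign.
by case: unliftP => [j|] _ //; case: unliftP => [k|] _.
Qed.

Hypothesis V_IZF : model_IZF (univ V).

Lemma V_union2 s a b : le s (⋁ c, ⋀ z, z ∈ c ⇔ z ∈ a ⊔ z ∈ b).
Proof.
have K := V_pair V_IZF s a b; iex K => q Hq.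
have K := V_union V_IZF s q; iex K => c Hc; apply: (ex_i (i := c)).
apply: all_i => z; iiff => K.
  have {}K := iff_l (all_e Hc z) K; iex K => y /and_e[yq zy].
  by have K := iff_l (all_e Hq y) yq; ior K => K; [apply: or_l|apply: or_r];
    apply: mem_r K zy.
apply: (iff_r (all_e Hc z)); ior K => K; [apply: (ex_i (i := a))|apply: (ex_i (i := b))];
  apply: and_i => //.
  exact: mem_pair_l Hq.
exact: mem_pair_r Hq.
Qed.

Lemma sub_univ_i s x y : le s (⋀ z, z ∈ x ⇒ z ∈ y) -> le s (sub_in (univ V) x y).
Proof. by move=> H; iallin => z _; apply: all_e H z. Qed.

Lemma sub_univ_e s x y z : le s (sub_in (univ V) x y) -> le s (z ∈ x) -> le s (z ∈ y).
Proof. by move=> /allin_e H; apply: imp_e; apply/H/le_top. Qed.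

(* b is the union of the successors of the ordinals in a. *)
Lemma ordinal_above s a : le s (⋁ b, is_ordinal b ⊓ ⋀ x, x ∈ a ⇒ is_ordinal x ⇒ x ∈ b).
Proof.
have K := V_union V_IZF s a; iex K => u Hu.
(* The elements of successors of elements of a all lie in ⋃a ∪ a, which serves as the bound for
   Separation. *)
have K := V_union2 s u a; iex K => c Hc.
have K := @V_sep _ _ V_IZF s (fun g => ⋁ x, x ∈ a ⊓ is_ordinal x ⊓ (g ∈ x ⊔ g ≈ x)) c.
have {K} : le s (⋁ b, ⋀ g, g ∈ b ⇔ g ∈ c ⊓ ⋁ x, x ∈ a ⊓ is_ordinal x ⊓ (g ∈ x ⊔ g ≈ x)).
  by apply: K; vdfn.
move=> K; iex K => b Hb.
have Hb1 : le s (⋀ g, ⋀ x, x ∈ a ⇒ is_ordinal x ⇒ g ∈ x ⊔ g ≈ x ⇒ g ∈ b).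
  apply: all_i => g; apply: all_i => x; iimp => xa; iimp => ox; iimp => gx.
  apply: (iff_r (all_e Hb g)); apply: and_i; last first.
    by apply: (ex_i (i := x)); do 2?apply: and_i.
  apply: (iff_r (all_e Hc g)); ior gx => gx; last by apply: or_r (mem_l (eqv_sym gx) xa).
  by apply: or_l; apply: (iff_r (all_e Hu g)); apply: (ex_i (i := x)); apply: and_i.
apply: (ex_i (i := b)); apply: and_i; last first.
  apply: all_i => x; iimp => xa; iimp => ox; apply: imp_e (or_r _ (eqv_refl s x)).
  exact: imp_e (imp_e (all_e (all_e Hb1 x) x) xa) ox.
apply: and_i; apply: all_i => g; iimp => gb; move/and_r: (iff_l (all_e Hb g) gb) => K;
  iex K => x /and_e[xa /and_e[ox gx]].
  apply: sub_univ_i; apply: all_i => t; iimp => tg.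
  apply: imp_e (imp_e (imp_e (all_e (all_e Hb1 t) x) xa) ox) _; apply: or_l.
  ior gx => gx; last exact: mem_r gx tg.
  exact: sub_univ_e (imp_e (all_e (and_l ox) g) gx) tg.
ior gx => gx; first exact: (imp_e (all_e (and_r ox) g) gx).
by apply: (V_subst (P := @transitive_set O V)) (eqv_sym gx) (and_l ox); vdfn.
Qed.

(** Ordinals need not be linearly ordered here, so no largest or least index is chosen. Collection
    may also return sets that are not ordinals, which [ordinal_above] disregards; its ordinal has
    all the relevant indices as members, so monotonicity along ∈ is enough. *)
Lemma hierarchy_almost_universal (M : V -> O) :
  has_external_cumulative_hierarchy M -> almost_universal M.
Proof.
move=> [R [R_def R_fun R_in R_union R_mono]]; have R_dfn := Dfn_rel R_def.
apply: all_i => x; apply: imp_i => s _ Hx.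
have {}R_fun := le_trans (le_top s) R_fun; have {}R_in := le_trans (le_top s) R_in.
have {}R_union := le_trans (le_top s) R_union.
have {}R_mono := le_trans (le_top s) R_mono.
have K : le s (⋁ b, ⋀ z, z ∈ x ⇒ ⋁ a, a ∈ b ⊓ is_ordinal a ⊓ ⋁ y, R a y ⊓ z ∈ y).
  apply: (V_coll V_IZF (P := fun z a => is_ordinal a ⊓ ⋁ y, R a y ⊓ z ∈ y)); first by vdfn.
  apply: all_i => z; iimp => zx.
  exact: iff_l (all_e R_union z) (imp_e (all_e Hx z) zx).
iex K => b Hb; have K := ordinal_above s b; iex K => c /and_e[oc Hc].
have K := allin_e R_fun oc; iex K => y /and_l Ry.
apply: (exin_i (x := y)); first exact: imp_e (all_e (allin_e R_in oc) y) Ry.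
apply: sub_univ_i; apply: all_i => z; iimp => zx.
have K := imp_e (all_e Hb z) zx; iex K => a /and_e[ab /and_e[oa K]].
iex K => y' /and_e[Ry' zy'].
have ac := imp_e (imp_e (all_e Hc a) ab) oa.
have K := all_e (all_e (imp_e (allin_e (allin_e R_mono oc) oa) ac) y) y'.
exact: sub_univ_e (imp_e (imp_e K Ry) Ry') zy'.
Qed.

(** Almost universality applied to the empty set, a subset of M, produces an element of M. *)
Lemma hierarchy_inhabited (M : V -> O) s :
  has_external_cumulative_hierarchy M -> le s (sup M).
Proof.
move=> /hierarchy_almost_universal H.
have K := le_trans (le_top s) (izf_empty_set V_IZF); iex K => x /and_r Hx.
have K := all_e (le_trans (le_top s) H) x.
have {}K : le s (⋁ y :in M, sub_in (univ V) x y).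
  apply: imp_e K _; apply: all_i => z; iimp => zx; apply: bot_e.
  exact: imp_e (allin_e Hx (le_top _)) zx.
by iex K => y /and_l; apply: (ex_i (i := y)).
Qed.

End Hierarchy.

(** * Sets of tuples *)

Section Tuples.

Variables (O : cHeyting) (V : structure O).
Hypothesis V_IZF : model_IZF (univ V).
Implicit Types (s : O) (x y z a b p q t : V).

Definition tl n (e : 'I_n.+1 -> V) (i : 'I_n) : V := e (lift ord0 i).

Lemma tl_scons n x (e : 'I_n -> V) : tl (scons x e) = e.
Proof. by apply: functional_extensionality => i; rewrite /tl sconsS. Qed.

Lemma scons_hd n (e : 'I_n.+1 -> V) : scons (e ord0) (tl e) = e.
Proof. exact: scons_eta. Qed.

(* t = <e 0, <e 1, ... <e n.-1, ∅>>> *)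
Fixpoint tuple_val n t : ('I_n -> V) -> O :=
  match n return ('I_n -> V) -> O with
  | 0 => fun _ => ⋀ z, ∼ (z ∈ t)
  | n.+1 => fun e => ⋁ r, is_opair t (e ord0) r ⊓ tuple_val r (tl e)
  end.

Lemma tuple_ex s n (e : 'I_n -> V) : le s (⋁ t, tuple_val t e).
Proof.
elim: n s e => [|n IH] s e /=.
  have K := le_trans (le_top s) (izf_empty_set V_IZF); iex K => x /and_r Hx.
  by apply: (ex_i (i := x)); apply: all_i => z; apply: (allin_e Hx) (le_top _).
have K := IH s (tl e); iex K => r Hr.
have K := opair_ex V_IZF s (e ord0) r; iex K => t Ht; apply: (ex_i (i := t)).
by apply: (ex_i (i := r)); apply: and_i.
Qed.

Lemma tuple_congr s n t t' (e e' : 'I_n -> V) : le s (t ≈ t') ->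
  (forall i, le s (e i ≈ e' i)) -> le s (tuple_val t e) -> le s (tuple_val t' e').
Proof.
elim: n s t t' e e' => [|n IH] s t t' e e' tt' ee' /= H.
  apply: all_i => z; iimp => K; apply: (imp_e (all_e H z)).
  exact: mem_r (eqv_sym tt') K.
iex H => r /and_e[Hr Kr]; apply: (ex_i (i := r)); apply: and_i.
  exact: (opair_congr Hr tt' (ee' ord0) (eqv_refl _ _)).
by apply: IH Kr; [apply: eqv_refl|move=> i; apply: ee'].
Qed.

Lemma tuple_inj s n t (e e' : 'I_n -> V) : le s (tuple_val t e) ->
  le s (tuple_val t e') -> forall i, le s (e i ≈ e' i).
Proof.
elim: n s t e e' => [|n IH] s t e e' /= H H' i; first by case: i.
iex H => r /and_e[Hr Kr]; iex H' => r' /and_e[Hr' Kr'].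
have [h1 h2] := opair_inj V_IZF Hr Hr'.
case: (unliftP ord0 i) => [j|] -> //.
exact: (IH _ _ _ _ Kr (tuple_congr (eqv_sym h2) (fun _ => eqv_refl _ _) Kr') j).
Qed.

(** Variable 0, the one a quantifier binds, is the head of the code, so that binding it corresponds
    to taking a range or sections. *)
Definition tuples n (X : 'I_n -> V) (Q : ('I_n -> V) -> O) t : O :=
  sup (fun e : 'I_n -> V => (⋀ i, e i ∈ X i) ⊓ tuple_val t e ⊓ Q e).

Lemma tuples_i s n (X e : 'I_n -> V) Q t : (forall i, le s (e i ∈ X i)) ->
  le s (tuple_val t e) -> le s (Q e) -> le s (tuples X Q t).
Proof. by move=> *; apply: (ex_i (i := e)); do 2?apply: and_i => //; apply: all_i. Qed.

(** A code determines its coordinates only up to ≈, hence the congruence hypothesis on Q. *)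
Lemma tuples_val s n (X e : 'I_n -> V) Q t : congruent Q ->
  le s (tuple_val t e) -> le s (tuples X Q t) -> le s (Q e).
Proof.
move=> cQ te K; iex K => e' /and_e[_ /and_e[te' Qe']].
by apply: cQ Qe'; apply: tuple_inj te' te.
Qed.

Lemma tuples_cons_i s n (X : 'I_n.+1 -> V) Q t x r : le s (x ∈ X ord0) ->
  le s (is_opair t x r) -> le s (tuples (tl X) (fun e => Q (scons x e)) r) ->
  le s (tuples X Q t).
Proof.
move=> xX tr K; iex K => e /and_e[He /and_e[re Qe]].
apply: tuples_i Qe => [i|/=].
  by case: (unliftP ord0 i) => [j|] ->; rewrite ?scons0 ?sconsS //; apply: all_e He j.
by apply: (ex_i (i := r)); rewrite scons0 tl_scons; apply: and_i.
Qed.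

Lemma tuples_cons_e s n (X : 'I_n.+1 -> V) Q t : le s (tuples X Q t) ->
  le s (⋁ x, ⋁ r, x ∈ X ord0 ⊓ is_opair t x r ⊓ tuples (tl X) (fun e => Q (scons x e)) r).
Proof.
move=> K; iex K => e /and_e[He /and_e[re Qe]]; iex re => r /and_e[tr re].
apply: (ex_i (i := e ord0)); apply: (ex_i (i := r)); apply: and_i; first exact: all_e He _.
apply: (and_i tr); apply: tuples_i re _; first by move=> i; apply: all_e He _.
by rewrite scons_hd.
Qed.

Lemma tuples_mono s n (X : 'I_n -> V) Q Q' t : le s (⋀ e, Q e ⇒ Q' e) ->
  le s (tuples X Q t) -> le s (tuples X Q' t).
Proof.
move=> H K; iex K => e /and_e[He /and_e[re Qe]].
by apply: tuples_i re (imp_e (all_e H e) Qe) => i; apply: all_e He _.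
Qed.

Lemma tuples_eq s n (X : 'I_n -> V) Q t t' : le s (t ≈ t') ->
  le s (tuples X Q t) -> le s (tuples X Q t').
Proof.
move=> H K; iex K => e /and_e[He /and_e[re Qe]].
apply: tuples_i Qe => [i|]; first exact: all_e He _.
exact: tuple_congr H (fun _ => eqv_refl _ _) re.
Qed.

End Tuples.

(** * Classes closed under the fundamental operations *)

Section Closed.

Variables (O : cHeyting) (V : structure O) (M : V -> O).
Hypothesis V_IZF : model_IZF (univ V).
Implicit Types (s : O) (x y z a b p q t u v w : V).

(** The class of all t with [P t] is an element of M. With [op_val F x y] for P this is the
    conclusion of [closed_fundamental]. *)
Definition inM (P : V -> O) : O := ⋁ w :in M, ⋀ t, t ∈ w ⇔ P t.

Lemma inM_ext s P Q : le s (⋀ t, P t ⇔ Q t) -> le s (inM P) -> le s (inM Q).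
Proof.
move=> H K; iex K => w /and_e[Mw Hw]; apply: (exin_i Mw); apply: all_i => t.
iiff => L; first exact: (iff_l (all_e H t) (iff_l (all_e Hw t) L)).
exact: (iff_r (all_e Hw t) (iff_r (all_e H t) L)).
Qed.

Hypothesis M_resp : respects M.
Hypothesis M_trans : forall s x y, le s (M y) -> le s (x ∈ y) -> le s (M x).

Lemma inM_sep s (P : V -> O) a : (forall n (phi : form n.+1), ⊩ Separation M phi) ->
  Dfn M s (fun e => P (e 0)) -> le s (M a) -> le s (inM (fun x => x ∈ a ⊓ P x)).
Proof.
move=> sep HP Ma; have K := Separation_Dfn sep HP Ma.
iex K => b /and_e[Mb Hb]; apply: (exin_i Mb); apply: all_i => x; iiff => K.
  exact: iff_l (allin_e Hb (M_trans Mb K)) K.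
exact: iff_r (allin_e Hb (M_trans Ma (and_l K))) K.
Qed.

Hypothesis M_closed : closed_fundamental M.
Hypothesis M_inh : forall s, le s (sup M).

Lemma inM_op F s x y : le s (M x) -> le s (M y) -> le s (inM (op_val F x y)).
Proof.
move=> Mx My; have K := le_trans (le_top s) (M_closed F).
exact: (allin_e (allin_e K Mx) My).
Qed.

Lemma inM_pair s x y : le s (M x) -> le s (M y) -> le s (⋁ w :in M, is_pair w x y).
Proof. exact: (@inM_op Op_pair). Qed.

Lemma inM_union2 s x y : le s (M x) -> le s (M y) -> le s (inM (fun t => t ∈ x ⊔ t ∈ y)).
Proof.
move=> Mx My; have K := inM_pair Mx My; iex K => w /and_e[Mw Hw].
apply: (inM_ext _ (@inM_op Op_union _ w w Mw Mw)); apply: all_i => t; iiff => /= K.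
  iex K => z /and_e[zw tz]; have K := iff_l (all_e Hw z) zw; ior K => K.
    by apply: or_l; apply: mem_r K tz.
  by apply: or_r; apply: mem_r K tz.
ior K => K; [apply: (ex_i (i := x))|apply: (ex_i (i := y))]; apply: and_i K.
  exact: mem_pair_l Hw.
exact: mem_pair_r Hw.
Qed.

(** The intersection is x ∩ ⋂{y, y}. *)
Lemma inM_inter s x y : le s (M x) -> le s (M y) -> le s (inM (fun t => t ∈ x ⊓ t ∈ y)).
Proof.
move=> Mx My; have K := inM_pair My My; iex K => w /and_e[Mw Hw].
apply: (inM_ext _ (@inM_op Op_bigcap _ x w Mx Mw)); apply: all_i => t; iiff => /= /and_e[tx K].
  exact: (and_i tx (imp_e (all_e K y) (mem_pair_l Hw))).
apply: (and_i tx); apply: all_i => z; iimp => zw; have L := iff_l (all_e Hw z) zw.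
by ior L => L; apply: mem_r (eqv_sym L) K.
Qed.

Lemma inM_opair s x y : le s (M x) -> le s (M y) -> le s (⋁ p :in M, is_opair p x y).
Proof.
move=> Mx My; have K := opair_ex V_IZF s x y; iex K => p Hp.
apply: (exin_i (x := p)) => //.
have K := inM_pair Mx Mx; iex K => q /and_e[Mq Hq].
have K := inM_pair Mx My; iex K => r /and_e[Mr Hr].
have K := inM_pair Mq Mr; iex K => p' /and_e[Mp' Hp'].
apply: M_resp Mp'; apply: V_ext => //; apply: all_i => z; iiff => K.
  apply: (iff_r (all_e Hp z)); have {}K := iff_l (all_e Hp' z) K; ior K => K; [apply: or_l|apply: or_r].
    by apply: (V_subst (P := fun u => is_pair u x x)) (eqv_sym K) Hq; vdfn.
  by apply: (V_subst (P := fun u => is_pair u x y)) (eqv_sym K) Hr; vdfn.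
apply: (iff_r (all_e Hp' z)); have {}K := iff_l (all_e Hp z) K; ior K => K; [apply: or_l|apply: or_r].
  exact: (is_pair_unique V_IZF K Hq).
exact: (is_pair_unique V_IZF K Hr).
Qed.

Lemma inM_empty s : le s (⋁ x :in M, ⋀ z, ∼ (z ∈ x)).
Proof.
have K := M_inh s; iex K => x Mx.
have K := @inM_op Op_diff _ x x Mx Mx; iex K => w /and_e[Mw Hw].
apply: (exin_i Mw); apply: all_i => z; iimp => K.
by case/and_e: (iff_l (all_e Hw z) K) => h1 h2; apply: imp_e h2 h1.
Qed.

Definition pairs (r : V -> V -> O) t : O := ⋁ u, ⋁ v, is_opair t u v ⊓ r u v.

Definition respects2 (r : V -> V -> O) := forall s u u' v v',
  le s (u ≈ u') -> le s (v ≈ v') -> le s (r u v) -> le s (r u' v').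

Lemma pairs_i s r t u v : le s (is_opair t u v) -> le s (r u v) -> le s (pairs r t).
Proof. by move=> H K; apply: (ex_i (i := u)); apply: (ex_i (i := v)); apply: and_i. Qed.

Lemma pairs_e s r t u v : respects2 r -> le s (is_opair t u v) -> le s (pairs r t) -> le s (r u v).
Proof.
move=> Rr H K; iex K => u' K; iex K => v' /and_e[H' K].
by have [h1 h2] := opair_inj V_IZF H' H; apply: Rr h1 h2 K.
Qed.

Lemma opair_mem_pairs s w r u v : respects2 r -> le s (⋀ t, t ∈ w ⇔ pairs r t) ->
  le s (opair_mem u v w) -> le s (r u v).
Proof.
move=> Rr Hw K; iex K => p /and_e[Hp pw].
exact: pairs_e Hp (iff_l (all_e Hw p) pw).
Qed.

Lemma pairs_opair_mem s w r u v : le s (⋀ t, t ∈ w ⇔ pairs r t) ->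
  le s (r u v) -> le s (opair_mem u v w).
Proof.
move=> Hw K; have L := opair_ex V_IZF s u v; iex L => p Hp; apply: (ex_i (i := p)).
by apply: (and_i Hp); apply: (iff_r (all_e Hw p)); apply: pairs_i K.
Qed.

(** M is closed under taking r ∩ (x × y), which is the form in which an atomic formula in two
    variables is handled. *)
Definition rel_inM (r : V -> V -> O) := forall s x y, le s (M x) -> le s (M y) ->
  le s (inM (pairs (fun u v => u ∈ x ⊓ v ∈ y ⊓ r u v))).

Lemma rel_inM_top : rel_inM (fun _ _ => top).
Proof.
move=> s x y Mx My; apply: (inM_ext _ (@inM_op Op_prod _ x y Mx My)).
apply: all_i => t; iiff => /= K; iex K => u K; iex K => v.
  case/and_e=> [ux /and_e[vy H]]; apply: (pairs_i H).
  by do 2?[apply: and_i => //]; apply: le_top.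
case/and_e=> [H /and_e[ux /and_e[vy _]]].
by apply: (ex_i (i := u)); apply: (ex_i (i := v)); do 2?apply: and_i.
Qed.

Lemma rel_inM_eq : rel_inM (fun u v => u ≈ v).
Proof.
move=> s x y Mx My; apply: (inM_ext _ (@inM_op Op_eq _ y x My Mx)).
apply: all_i => t; iiff => /= K; iex K => u K; iex K => v.
  case/and_e=> [ux /and_e[vy /and_e[H L]]]; apply: (pairs_i H).
  by do 2?[apply: and_i => //]; apply: eqv_sym.
case/and_e=> [H /and_e[ux /and_e[vy L]]].
apply: (ex_i (i := u)); apply: (ex_i (i := v)); do 3?apply: and_i => //.
exact: eqv_sym.
Qed.

(** [Op_mem] puts the larger set first, so it yields the converse of membership; [rel_inM_inv] later
    turns it round. *)
Lemma rel_inM_mem_rev : rel_inM (fun u v => v ∈ u).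
Proof.
move=> s x y Mx My; apply: (inM_ext _ (@inM_op Op_mem _ y x My Mx)).
apply: all_i => t; iiff => /= K; iex K => u K; iex K => v.
  case/and_e=> [ux /and_e[vy /and_e[H L]]]; apply: (pairs_i H).
  by do 2?[apply: and_i => //].
case/and_e=> [H /and_e[ux /and_e[vy L]]].
by apply: (ex_i (i := u)); apply: (ex_i (i := v)); do 3?apply: and_i => //.
Qed.

Lemma respects2_and x y r : respects2 r -> respects2 (fun u v => u ∈ x ⊓ v ∈ y ⊓ r u v).
Proof.
move=> Rr s u u' v v' hu hv /and_e[h1 /and_e[h2 h3]]; apply: and_i; first exact: mem_l hu h1.
by apply: and_i; [apply: mem_l hv h2|apply: Rr h3].
Qed.

Lemma respects2_eq : respects2 (fun u v => u ≈ v).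
Proof. by move=> s u u' v v' hu hv h; apply: eqv_trans (eqv_sym hu) (eqv_trans h hv). Qed.

Lemma respects2_mem : respects2 (fun u v => u ∈ v).
Proof. move=> s u u' v v'; exact: mem_congr. Qed.

(* The converse of W = r ∩ (x × y) is the range of                            *)
(* {<u, v, w> : <u, v> ∈ W, w ∈ x} ∩ {<u, v, w> : <u, w> ∈ x × x, u = w, v ∈ y}. *)
Lemma rel_inM_inv r : respects2 r -> rel_inM r -> rel_inM (fun u v => r v u).
Proof.
move=> Rr Hr s y x My Mx.
have K := Hr s x y Mx My; iex K => W /and_e[MW HW].
have K := rel_inM_eq Mx Mx; iex K => E /and_e[ME HE].
have K := @inM_op Op_triple_right _ W x MW Mx; iex K => A /and_e[MA HA].
have K := @inM_op Op_triple_mid _ E y ME My; iex K => B /and_e[MB HB].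
have K := inM_inter MA MB; iex K => C /and_e[MC HC].
apply: (inM_ext _ (@inM_op Op_ran _ C C MC MC)); apply: all_i => t; iiff => /= K.
  iex K => z /and_e[zC K]; iex K => c Hz.
  have [zA zB] := and_e (iff_l (all_e HC z) zC).
  have {zA}K := iff_l (all_e HA z) zA; rewrite /= in K.
  iex K => u K; iex K => v K; iex K => w /and_e[uvW /and_e[wx K]]; iex K => q /and_e[Hq Hzq].
  have {zB}K := iff_l (all_e HB z) zB; rewrite /= in K.
  iex K => u' K; iex K => v' K; iex K => w' /and_e[uvE /and_e[wy K]]; iex K => q' /and_e[Hq' Hzq'].
  have [uu' qq'] := opair_inj V_IZF Hzq Hzq'.
  have [_ tq] := opair_inj V_IZF Hzq Hz.
  have [_ wv'] := opair_inj V_IZF (opair_congr Hq qq' (eqv_refl _ _) (eqv_refl _ _)) Hq'.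
  have /and_e[_ /and_e[_ u'v']] := opair_mem_pairs (respects2_and respects2_eq) HE uvE.
  have /and_e[ux /and_e[vy ruv]] := opair_mem_pairs (respects2_and Rr) HW uvW.
  have uw : le s (u ≈ w) := eqv_trans uu' (eqv_trans u'v' (eqv_sym wv')).
  apply: (pairs_i (opair_congr Hq tq (eqv_refl _ _) (eqv_sym uw))).
  by do 2?apply: and_i.
iex K => v K; iex K => u /and_e[Ht /and_e[vy /and_e[ux ruv]]].
have K := opair_ex V_IZF s u t; iex K => z Hz; apply: (ex_i (i := z)); apply: and_i; last first.
  exact: (ex_i (i := u)).
apply: (iff_r (all_e HC z)); apply: and_i.
  apply: (iff_r (all_e HA z)); apply: (ex_i (i := u)); apply: (ex_i (i := v)); apply: (ex_i (i := u)).
  apply: and_i; first by apply: (pairs_opair_mem HW); do 2?apply: and_i.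
  by apply: (and_i ux); apply: (ex_i (i := t)); apply: and_i.
apply: (iff_r (all_e HB z)); apply: (ex_i (i := u)); apply: (ex_i (i := u)); apply: (ex_i (i := v)).
apply: and_i; first by apply: (pairs_opair_mem HE); do 2?apply: and_i => //; apply: eqv_refl.
by apply: (and_i vy); apply: (ex_i (i := t)); apply: and_i.
Qed.

End Closed.

(** * Definability in V of satisfaction in M and of sets of tuples *)

Section DefinableTuples.

Variables (O : cHeyting) (V : structure O) (M : V -> O).
Implicit Types (s : O) (x : V).

Local Notation Dfnu := (Dfn (univ V)).

(** [tuples] takes a supremum over functions ['I_n -> V], which is not a quantifier of the language.
    It amounts to n nested existential quantifiers, whose values occupy the first n coordinates of
    the environment. *)
Lemma Dfn_finsup s n (F : ('I_n -> V) -> (nat -> V) -> O) :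
  Dfnu s (fun e => F (fun i => e i) (fun k => e (n + k)%N)) ->
  Dfnu s (fun e => sup (fun u => F u e)).
Proof.
elim: n s F => [|n IH] s F H.
  apply: (Dfn_ext H) => s' e l _ /=.
  have E (u : 'I_0 -> V) : u = (fun i => e i).
    by apply: functional_extensionality => i; case: i.
  iiff => K; first by iex K => u; rewrite (E u).
  exact: (ex_i (i := fun i : 'I_0 => e i)).
apply: (@Dfn_ext _ _ _ _ _ (fun e => sup (fun u => ⋁ x, F (scons x u) e))); last first.
  move=> s' e l _; iiff => K.
    iex K => u Hu; apply: (ex_i (i := tl u)); apply: (ex_i (i := u ord0)).
    by rewrite scons_hd.
  iex K => u K; iex K => x; exact: (ex_i (i := scons x u)).
apply: (IH s (fun u e => ⋁ x, F (scons x u) e)); apply: Dfn_ex; last by move=> *; apply: le_top.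
apply: (Dfn_ext H) => s' e l _.
rewrite (_ : scons _ _ = (fun i : 'I_n.+1 => e i)); first exact: iff_refl.
by apply: functional_extensionality => i; rewrite /scons; case: unliftP => [j|] ->.
Qed.

Lemma Dfn_fininf s n (F : 'I_n -> (nat -> V) -> O) :
  (forall i, Dfnu s (F i)) -> Dfnu s (fun e => ⋀ i, F i e).
Proof.
elim: n s F => [|n IH] s F H.
  apply: (Dfn_ext (Dfn_top _ _)) => s' e l _.
  by iiff => _; [apply: le_top|apply: all_i => i; case: i].
apply: (Dfn_ext (Dfn_and (H ord0) (IH s (fun i => F (lift ord0 i)) (fun i => H _)))).
move=> s' e l _; iiff => K.
  by apply: and_i; [apply: all_e K _|apply: all_i => i; apply: (all_e K)].
case/and_e: K => h K; apply: all_i => i.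
by case: (unliftP ord0 i) => [j|] -> //; apply: all_e K j.
Qed.

Lemma Dfn_tuple_val s n (t : (nat -> V) -> V) (u : 'I_n -> (nat -> V) -> V) :
  term (univ V) s t -> (forall i, term (univ V) s (u i)) ->
  Dfnu s (fun e => tuple_val (t e) (fun i => u i e)).
Proof.
elim: n t u => [|n IH] t u Ht Hu /=.
  apply: Dfn_all; last by vfacts.
  by apply: Dfn_imp (Dfn_bot _ _); apply: Dfn_mem (term_shift Ht); apply: term_var.
apply: Dfn_ex; last by vfacts.
apply: Dfn_and.
  by apply: Dfn_is_opair; (vfacts || apply: term_shift).
apply: (IH (fun e => e 0) (fun i e => u (lift ord0 i) (fun k => e k.+1))).
  exact: term_var.
by move=> i; apply: term_shift.
Qed.

Hypothesis M_dfn : forall s t, term (univ V) s t -> Dfnu s (fun e => M (t e)).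

(** A relativized quantifier is an ordinary quantifier guarded by M, and M is definable. The
    function [lft] carries the terms under a binder. *)
Lemma Dfn_sat s n (phi : form n) (u : 'I_n -> (nat -> V) -> V) :
  (forall i, term (univ V) s (u i)) -> Dfnu s (fun e => sat M phi (fun i => u i e)).
Proof.
pose lft n (u : 'I_n -> (nat -> V) -> V) (i : 'I_n.+1) (e : nat -> V) :=
  if unlift ord0 i is Some j then u j (fun k => e k.+1) else e 0.
have lft_term m (v : 'I_m -> (nat -> V) -> V) : (forall i, term (univ V) s (v i)) ->
    forall i, term (univ V) s (lft _ v i).
  move=> Hv i; rewrite /lft; case: unlift => [j|]; last exact: term_var.
  exact: term_shift.
have lftE m (v : 'I_m -> (nat -> V) -> V) e :
    scons (e 0) (fun i => v i (fun k => e k.+1)) = (fun i => lft _ v i e).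
  by apply: functional_extensionality => i; rewrite /scons /lft; case: unlift.
elim: phi u => {n} [n i j|n i j|n|n f IHf g IHg|n f IHf g IHg
    |n f IHf g IHg|n f IHf|n f IHf] u Hu /=.
- exact: Dfn_mem.
- exact: Dfn_eq.
- exact: Dfn_bot.
- by apply: Dfn_and; [apply: IHf|apply: IHg].
- by apply: Dfn_or; [apply: IHf|apply: IHg].
- by apply: Dfn_imp; [apply: IHf|apply: IHg].
- apply: Dfn_all; last by vfacts.
  apply: Dfn_imp; first by apply: M_dfn; apply: term_var.
  apply: (Dfn_ext (IHf _ (lft_term _ _ Hu))) => s' e l _; rewrite lftE; exact: iff_refl.
- apply: Dfn_ex; last by vfacts.
  apply: Dfn_and; first by apply: M_dfn; apply: term_var.
  apply: (Dfn_ext (IHf _ (lft_term _ _ Hu))) => s' e l _; rewrite lftE; exact: iff_refl.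
Qed.

Lemma term_shiftn s n t : term (univ V) s t -> term (univ V) s (fun e => t (fun k => e (n + k)%N)).
Proof. by case=> [k|c Hc]; [apply: term_var|apply: term_cst]. Qed.

Lemma Dfn_tuples s n (X : 'I_n -> V) (phi : form n.+1) (v t : (nat -> V) -> V) :
  term (univ V) s v -> term (univ V) s t ->
  Dfnu s (fun e => tuples X (fun u => sat M phi (scons (v e) u)) (t e)).
Proof.
move=> Hv Ht; apply: Dfn_finsup; apply: Dfn_and; last apply: Dfn_and.
- by apply: Dfn_fininf => i; apply: Dfn_mem; [apply: term_var|apply: term_cst; apply: le_top].
- apply: (Dfn_tuple_val (u := fun (i : 'I_n) e => e i)); first exact: term_shiftn Ht.
  by move=> i; apply: term_var.
pose u (i : 'I_n.+1) (e : nat -> V) := if unlift ord0 i is Some j then e j else v (fun k => e (n + k)%N).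
apply: (Dfn_ext (Dfn_sat phi (u := u) _)).
  move=> i; rewrite /u; case: unlift => [j|]; [exact: term_var|exact: term_shiftn Hv].
move=> s' e l _; rewrite (_ : scons _ _ = (fun i => u i e)); first exact: iff_refl.
by apply: functional_extensionality => i; rewrite /scons /u; case: unlift.
Qed.

End DefinableTuples.

(** * Bounding a quantifier over M by an element of M *)

Section Bounding.

Variables (O : cHeyting) (V : structure O) (M : V -> O).
Implicit Types (s : O) (x y z a b p q t v w : V).
Hypothesis V_IZF : model_IZF (univ V).
Hypothesis M_dfn : forall s (t : (nat -> V) -> V), term (univ V) s t -> Dfn (univ V) s (fun e => M (t e)).
Hypothesis M_resp : respects M.
Hypothesis M_trans : forall s x y, le s (M y) -> le s (x ∈ y) -> le s (M x).
Hypothesis M_au : almost_universal M.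

Lemma M_cover s x : le s (⋀ z, z ∈ x ⇒ M z) -> le s (⋁ y :in M, ⋀ z, z ∈ x ⇒ z ∈ y).
Proof.
move=> H; have K := imp_e (all_e (le_trans (le_top s) M_au) x) H.
iex K => y /and_e[My K]; apply: (exin_i My); apply: all_i => z; iimp.
exact: sub_univ_e K.
Qed.

(* Two values v of the quantified variable are interchangeable when they      *)
(* define the same subset of T; as the subsets of T form a set, Collection    *)
(* yields a set Y of values of each possible behaviour. No negation is        *)
(* involved, so Y bounds universal and existential quantifiers alike.         *)
Lemma quantifier_bound s n (X : 'I_n -> V) (phi : form n.+1) T :
  le s (⋀ t, t ∈ T ⇔ tuples X (fun _ => top) t) ->
  le s (⋁ Y :in M, ⋀ v :in M, ⋁ v', v' ∈ Y ⊓ ⋀ e, (⋀ i, e i ∈ X i) ⇒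
    (sat M phi (scons v e) ⇔ sat M phi (scons v' e))).
Proof.
(* [cut v p] says that p is the subset of T defined by the value v. The set A below consists of the
   subsets so defined by values in M, and B contains a value in M for each of them. *)
move=> HT; pose Th v t := tuples X (fun u : 'I_n -> V => sat M phi (scons v u)) t.
pose cut v p := ⋀ t, t ∈ p ⇔ t ∈ T ⊓ Th v t.
have K := V_power V_IZF s T; iex K => P HP.
have K : le s (⋁ A, ⋀ p, p ∈ A ⇔ p ∈ P ⊓ ⋁ v, M v ⊓ cut v p).
  apply: (V_sep V_IZF); rewrite /cut /Th; vdfn.
  by apply: Dfn_tuples => //; apply: term_var.
iex K => A HA.
have K : le s (⋁ B, ⋀ p, p ∈ A ⇒ ⋁ v, v ∈ B ⊓ M v ⊓ cut v p).
  apply: (V_coll V_IZF (P := fun p v => M v ⊓ cut v p)).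
    by rewrite /cut /Th; vdfn; apply: Dfn_tuples => //; apply: term_var.
  by apply: all_i => p; iimp => pA; exact: and_r (iff_l (all_e HA p) pA).
iex K => B HB.
(* Collection may have put sets outside M into B, and only a subset of M can be covered by an
   element of M. *)
have K := @V_sep _ _ V_IZF s M B ltac:(vdfn); iex K => B' HB'.
have K : le s (⋀ z, z ∈ B' ⇒ M z).
  by apply: all_i => z; iimp => zB; exact: and_r (iff_l (all_e HB' z) zB).
have {}K := M_cover K; iex K => Y /and_e[MY HY]; apply: (exin_i MY).
iallin => v Mv.
have K : le s (⋁ p, cut v p).
  apply: (V_sep V_IZF (P := Th v)).
  apply: (@Dfn_tuples _ _ _ M_dfn s n X phi (fun _ => v) (fun e => e 0)).
    by apply: term_cst; apply: le_top.
  exact: term_var.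
iex K => p Hp.
have pA : le s (p ∈ A).
  apply: (iff_r (all_e HA p)); apply: and_i; last by apply: (ex_i (i := v)); apply: and_i.
  apply: (iff_r (all_e HP p)); apply: all_i => t; iimp => tp.
  exact: and_l (iff_l (all_e Hp t) tp).
have K := imp_e (all_e HB p) pA; iex K => v' /and_e[vB /and_e[Mv' Hp']].
apply: (ex_i (i := v')); apply: and_i.
  by apply: (imp_e (all_e HY v')); apply: (iff_r (all_e HB' v')); apply: and_i.
apply: all_i => e; iimp => He.
(* The code of e lies in T, so phi holds of w and e exactly when this code lies in p, and likewise
   for w'. *)
have key s1 (w w' : V) : le s1 (cut w p) -> le s1 (cut w' p) -> le s1 (⋀ i, e i ∈ X i) ->
    le s1 (⋀ t, t ∈ T ⇔ tuples X (fun _ => top) t) ->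
    le s1 (sat M phi (scons w e)) -> le s1 (sat M phi (scons w' e)).
  move=> Hw Hw' {}He {}HT K; have L := tuple_ex V_IZF s1 e; iex L => t te.
  have tp : le s1 (t ∈ p).
    apply: (iff_r (all_e Hw t)); apply: and_i.
      by apply: (iff_r (all_e HT t)); apply: tuples_i te (le_top _) => i; apply: all_e He i.
    by apply: tuples_i te K => i; apply: all_e He i.
  have := and_r (iff_l (all_e Hw' t) tp); apply: tuples_val te => //.
  move=> s2 u u' uu'; apply: sat_congr => // i.
  by rewrite /scons; case: unlift => [j|] //; apply: eqv_refl.
by iiff => K; [apply: (key _ v v')|apply: (key _ v' v)].
Qed.

End Bounding.

(** * Predicates whose sets of tuples belong to M *)

Section Good.

Variables (O : cHeyting) (V : structure O) (M : V -> O).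
Implicit Types (s : O) (x y z a b p q t v w : V).
Hypothesis V_IZF : model_IZF (univ V).
Hypothesis M_dfn : forall s (t : (nat -> V) -> V),
  term (univ V) s t -> Dfn (univ V) s (fun e => M (t e)).
Hypothesis M_resp : respects M.
Hypothesis M_trans : forall s x y, le s (M y) -> le s (x ∈ y) -> le s (M x).
Hypothesis M_closed : closed_fundamental M.
Hypothesis M_inh : forall s, le s (sup M).
Hypothesis M_au : almost_universal M.

Definition good n (Q : ('I_n -> V) -> O) := forall s (X : 'I_n -> V),
  (forall i, le s (M (X i))) -> le s (inM M (tuples X Q)).

Lemma inM_tuples_cons s n (X : 'I_n.+1 -> V) Q (r : V -> V -> O) :
  (forall s' u v, le s' s -> le s' (r u v) ->
     le s' (u ∈ X ord0) /\ le s' (tuples (tl X) (fun e => Q (scons u e)) v)) ->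
  (forall s' u v, le s' s -> le s' (u ∈ X ord0) ->
     le s' (tuples (tl X) (fun e => Q (scons u e)) v) -> le s' (r u v)) ->
  le s (inM M (pairs r)) -> le s (inM M (tuples X Q)).
Proof.
move=> H1 H2; apply: inM_ext; apply: all_i => t; apply: iff_i => s' l K.
  move: (K) => {}K; iex K => u K; iex K => v /and_e[Ht K].
  by have [h1 h2] := H1 _ _ _ l K; apply: tuples_cons_i h1 Ht h2.
have {}K := tuples_cons_e K; iex K => u K; iex K => v /and_e[ux /and_e[Ht K]].
by apply: (pairs_i Ht); apply: H2 l ux K.
Qed.

(** The only tuple of length 0 is ∅, so the set in question is {∅}. *)
Lemma good_nil : good (fun _ : 'I_0 -> V => top).
Proof.
move=> s X _; have K := inM_empty M_closed M_inh s; iex K => x /and_e[Mx Hx].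
apply: inM_ext (inM_pair M_closed Mx Mx); apply: all_i => t; iiff => K.
  apply: (tuples_i (e := X)); [by case|move=> /=|exact: le_top].
  have {}K : le s (x ≈ t) by ior K => K; apply: eqv_sym.
  by apply: all_i => z; iimp => zt; apply: (imp_e (all_e Hx z)); apply: mem_r (eqv_sym K) zt.
iex K => e /and_e[_ /and_e[/= Ht _]]; apply: or_l; apply: (V_ext V_IZF).
apply: all_i => z; iiff => zx; apply: bot_e; first exact: imp_e (all_e Ht z) zx.
exact: imp_e (all_e Hx z) zx.
Qed.

Lemma good_tl n (Q : ('I_n -> V) -> O) : good Q -> good (fun e : 'I_n.+1 -> V => Q (tl e)).
Proof.
move=> H s X MX; have K := H s (tl X) (fun i => MX _); iex K => W /and_e[MW HW].
have K := rel_inM_top M_closed (MX ord0) MW; apply: inM_tuples_cons K => s' u v l.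
  case/and_e=> [uX /and_e[vW _]]; split=> //; have K := iff_l (all_e (le_trans l HW) v) vW.
  by apply: tuples_mono K; apply: all_i => e; iimp; rewrite tl_scons.
move=> uX K; apply: (and_i uX); apply: and_i (le_top _).
apply: (iff_r (all_e (le_trans l HW) v)); apply: tuples_mono K.
by apply: all_i => e; iimp; rewrite tl_scons.
Qed.

Lemma good_top n : good (fun _ : 'I_n -> V => top).
Proof. by elim: n => [|n IH]; [exact: good_nil|exact: good_tl IH]. Qed.

Lemma good_bot n : good (fun _ : 'I_n -> V => bot).
Proof.
move=> s X MX; have K := inM_empty M_closed M_inh s; iex K => x /and_e[Mx Hx].
apply: (exin_i Mx); apply: all_i => t; iiff => K.
  by apply: bot_e; apply: imp_e (all_e Hx t) K.
by iex K => e /and_r/and_r; apply: bot_e.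
Qed.

(** The set is the product of X_0 ∩ P with the set of all tuples in the remaining bounds. *)
Lemma good_diag n (P : V -> O) :
  (forall s x, le s (M x) -> le s (inM M (fun t => t ∈ x ⊓ P t))) ->
  good (fun e : 'I_n.+1 -> V => P (e ord0)).
Proof.
move=> HP s X MX; have K := HP s _ (MX ord0); iex K => A /and_e[MA HA].
have K := good_top (X := tl X) (fun i => MX _); iex K => W /and_e[MW HW].
have K := rel_inM_top M_closed MA MW; apply: inM_tuples_cons K => s' u v l.
  case/and_e=> [uA /and_e[vW _]]; have [uX Pu] := and_e (iff_l (all_e (le_trans l HA) u) uA).
  split=> //; have K := iff_l (all_e (le_trans l HW) v) vW.
  apply: tuples_mono K; apply: all_i => e; iimp; rewrite scons0 => _; exact: Pu.
move=> uX K; apply: and_i; last first.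
  apply: and_i (le_top _); apply: (iff_r (all_e (le_trans l HW) v)); apply: tuples_mono K.
  by apply: all_i => e; iimp => _; apply: le_top.
apply: (iff_r (all_e (le_trans l HA) u)); apply: (and_i uX).
by iex K => e /and_r/and_r; rewrite scons0.
Qed.

(** Induction on the position of the second coordinate. If it comes directly after the first,
    [Op_triple_right] appends all tails to r ∩ (X_0 × X_1). Otherwise coordinate 1 is deleted, the
    induction hypothesis is applied, and [Op_triple_mid] inserts X_1 again just after the head. *)
Lemma good_rel0 n (j : 'I_n) r : respects2 r -> rel_inM M r ->
  good (fun e : 'I_n.+1 -> V => r (e ord0) (e (lift ord0 j))).
Proof.
move=> Rr Hr; elim: n j => [|n IH] j; first by case: j.
move=> s X MX; case: (unliftP ord0 j) => [k|] ->.
  pose X' := scons (X ord0) (tl (tl X)).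
  have MX' i : le s (M (X' i)) by rewrite /X' /scons; case: unlift => [i'|]; apply: MX.
  have K := IH k s X' MX'; iex K => W /and_e[MW HW].
  have K := inM_op M_closed Op_triple_mid MW (MX (lift ord0 ord0)).
  apply: inM_ext K; apply: all_i => t; iiff => /= K.
    iex K => u K; iex K => w K; iex K => v /and_e[uwW /and_e[vX K]]; iex K => q /and_e[Hq Ht].
    iex uwW => p' /and_e[Hp pW]; have K := tuples_cons_e (iff_l (all_e HW p') pW).
    iex K => u' K; iex K => w' /and_e[uX /and_e[Hp' K]].
    have [uu' ww'] := opair_inj V_IZF Hp' Hp.
    rewrite /X' scons0 in uX; rewrite /X' tl_scons in K.
    apply: (tuples_cons_i (mem_l uu' uX) Ht).
    apply: (tuples_cons_i vX Hq); apply: (tuples_eq ww').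
    apply: tuples_mono K; apply: all_i => e; iimp.
    rewrite !(scons0, sconsS); apply: Rr => //; exact: eqv_refl.
  have {}K := tuples_cons_e K; iex K => u K; iex K => q /and_e[uX /and_e[Ht K]].
  have {}K := tuples_cons_e K; iex K => v K; iex K => w /and_e[vX /and_e[Hq K]].
  apply: (ex_i (i := u)); apply: (ex_i (i := w)); apply: (ex_i (i := v)).
  apply: and_i; last by apply: (and_i vX); apply: (ex_i (i := q)); apply: and_i.
  have L := opair_ex V_IZF s u w; iex L => p Hp; apply: (ex_i (i := p)); apply: (and_i Hp).
  apply: (iff_r (all_e HW p)); apply: (tuples_cons_i _ Hp); first by rewrite /X' scons0.
  rewrite /X' tl_scons; apply: tuples_mono K; apply: all_i => e; iimp.
  by rewrite !(scons0, sconsS).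
have K := Hr s _ _ (MX ord0) (MX (lift ord0 ord0)); iex K => W /and_e[MW HW].
have K := good_top (X := tl (tl X)) (fun i => MX _); iex K => T /and_e[MT HT].
have K := inM_op M_closed Op_triple_right MW MT.
apply: inM_ext K; apply: all_i => t; iiff => /= K.
  iex K => u K; iex K => v K; iex K => w /and_e[uvW /and_e[wT K]]; iex K => q /and_e[Hq Ht].
  have /and_e[uX /and_e[vX ruv]] := opair_mem_pairs V_IZF (respects2_and Rr) HW uvW.
  apply: (tuples_cons_i uX Ht); apply: (tuples_cons_i vX Hq).
  apply: tuples_mono (iff_l (all_e HT w) wT); apply: all_i => e; iimp => _.
  by rewrite !(scons0, sconsS).
have {}K := tuples_cons_e K; iex K => u K; iex K => q /and_e[uX /and_e[Ht K]].
have {}K := tuples_cons_e K; iex K => v K; iex K => w /and_e[vX /and_e[Hq K]].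
apply: (ex_i (i := u)); apply: (ex_i (i := v)); apply: (ex_i (i := w)); apply: and_i.
  apply: (pairs_opair_mem V_IZF HW); do 2?apply: and_i => //.
  by iex K => e /and_r/and_r; rewrite !(scons0, sconsS).
apply: and_i; last by apply: (ex_i (i := q)); apply: and_i.
apply: (iff_r (all_e HT w)); apply: tuples_mono K.
by apply: all_i => e; iimp => _; apply: le_top.
Qed.

(** Leading coordinates involved in neither variable are split off by [good_tl]. Then one variable
    is 0: [good_rel0] applies to r or to its converse, and the hypothesis on [r t t] covers the case
    where both are 0. *)
Lemma good_rel n (i j : 'I_n) r : respects2 r -> rel_inM M r ->
  (forall s x, le s (M x) -> le s (inM M (fun t => t ∈ x ⊓ r t t))) ->
  good (fun e : 'I_n -> V => r (e i) (e j)).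
Proof.
move=> Rr Hr Hd; elim: n i j => [|n IH] i j; first by case: i.
case: (unliftP ord0 i) (unliftP ord0 j) => [i'|] -> [j'|] ->.
- exact: good_tl (IH i' j').
- apply: (@good_rel0 n i' (fun u v => r v u)); last exact: rel_inM_inv.
  by move=> s u u' v v' hu hv; apply: Rr.
- exact: good_rel0.
- exact: (good_diag Hd).
Qed.

Lemma good_eq n (i j : 'I_n) : good (fun e : 'I_n -> V => e i ≈ e j).
Proof.
apply: good_rel; [exact: respects2_eq|exact: rel_inM_eq|move=> s x Mx].
apply: (exin_i Mx); apply: all_i => t; iiff => [K|/and_l //].
by apply: (and_i K); apply: eqv_refl.
Qed.

Lemma mem_irrefl s x : le s (x ∈ x) -> le s bot.
Proof.
apply: imp_e; apply: (V_ind V_IZF (P := fun x => x ∈ x ⇒ bot)); first by vdfn.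
by apply: all_i => b; iimp => K; iimp => bb; apply: imp_e (imp_e (all_e K b) bb) bb.
Qed.

(** On the diagonal the set is empty, since no set belongs to itself. *)
Lemma good_mem n (i j : 'I_n) : good (fun e : 'I_n -> V => e i ∈ e j).
Proof.
apply: good_rel; first exact: respects2_mem.
  apply: (rel_inM_inv V_IZF M_closed (r := fun u v => v ∈ u)); last exact: rel_inM_mem_rev.
  by move=> s u u' v v' hu hv; apply: mem_congr.
move=> s x Mx; have K := inM_empty M_closed M_inh s; iex K => y /and_e[My Hy].
apply: (exin_i My); apply: all_i => t; iiff => K; apply: bot_e.
  exact: imp_e (all_e Hy t) K.
exact: mem_irrefl (and_r K).
Qed.

(** A code in both sets may come with two different families of coordinates, equal only up to ≈;
    congruence of Q' transfers it to the first family. *)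
Lemma good_and n (Q Q' : ('I_n -> V) -> O) : congruent Q' ->
  good Q -> good Q' -> good (fun e => Q e ⊓ Q' e).
Proof.
move=> cQ' HQ HQ' s X MX; have K := HQ s X MX; iex K => A /and_e[MA HA].
have K := HQ' s X MX; iex K => B /and_e[MB HB].
apply: inM_ext (inM_inter M_closed MA MB); apply: all_i => t; iiff => K.
  have [tA tB] := and_e K; have {tA}K := iff_l (all_e HA t) tA.
  iex K => e /and_e[He /and_e[te Qe]]; apply: (tuples_i _ te); first exact: all_e He.
  apply: (and_i Qe); exact: (tuples_val V_IZF cQ' te (iff_l (all_e HB t) tB)).
apply: and_i; [apply: (iff_r (all_e HA t))|apply: (iff_r (all_e HB t))];
  apply: tuples_mono K; apply: all_i => e; iimp => /and_e[] //.
Qed.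

Lemma good_or n (Q Q' : ('I_n -> V) -> O) : good Q -> good Q' -> good (fun e => Q e ⊔ Q' e).
Proof.
move=> HQ HQ' s X MX; have K := HQ s X MX; iex K => A /and_e[MA HA].
have K := HQ' s X MX; iex K => B /and_e[MB HB].
apply: inM_ext (inM_union2 M_closed MA MB); apply: all_i => t; iiff => K.
  ior K => K; [have {}K := iff_l (all_e HA t) K|have {}K := iff_l (all_e HB t) K];
    apply: tuples_mono K; apply: all_i => e; iimp; [exact: or_l|exact: or_r].
iex K => e /and_e[He /and_e[te K]].
ior K => K; [apply: or_l; apply: (iff_r (all_e HA t))|apply: or_r; apply: (iff_r (all_e HB t))];
  apply: tuples_i te K; exact: all_e He.
Qed.

(** With A and B the sets for Q and Q' and T the set of all tuples, the set is T ∩ {z : z ∈ A → z ∈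
    B}, the value of [Op_imp] at T and <A, B>. *)
Lemma good_imp n (Q Q' : ('I_n -> V) -> O) : congruent Q -> congruent Q' ->
  good Q -> good Q' -> good (fun e => Q e ⇒ Q' e).
Proof.
move=> cQ cQ' HQ HQ' s X MX; have K := HQ s X MX; iex K => A /and_e[MA HA].
have K := HQ' s X MX; iex K => B /and_e[MB HB].
have K := good_top MX; iex K => T /and_e[MT HT].
have K := inM_opair V_IZF M_resp M_closed MA MB; iex K => p /and_e[Mp Hp].
apply: inM_ext (inM_op M_closed Op_imp MT Mp); apply: all_i => t; iiff => /= K.
  have [tT {}K] := and_e K; iex K => a K; iex K => b /and_e[Hp' K].
  have [Aa Bb] := opair_inj V_IZF Hp Hp'.
  have {tT}L := iff_l (all_e HT t) tT; iex L => e /and_e[He /and_e[te _]].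
  apply: (tuples_i _ te); first exact: all_e He.
  iimp => Qe; apply: (tuples_val V_IZF cQ' te (iff_l (all_e HB t) _)).
  apply: mem_r (eqv_sym Bb) (imp_e K (mem_r Aa _)).
  by apply: (iff_r (all_e HA t)); apply: tuples_i te Qe; exact: all_e He.
apply: and_i.
  by apply: (iff_r (all_e HT t)); apply: tuples_mono K; apply: all_i => e; iimp => _; apply: le_top.
apply: (ex_i (i := A)); apply: (ex_i (i := B)); apply: (and_i Hp); iimp => tA.
iex K => e /and_e[He /and_e[te K]].
apply: (iff_r (all_e HB t)); apply: (tuples_i _ te); first exact: all_e He.
by apply: (imp_e K); exact: (tuples_val V_IZF cQ te (iff_l (all_e HA t) tA)).
Qed.

End Good.

(** * The set ω *)

Section Infinity.

Variables (O : cHeyting) (V : structure O).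
Implicit Types (s : O) (x y z a b p q t v w : V).

Definition is_empty x : O := ⋀ z, ∼ (z ∈ x).
Definition is_succ x y : O := ⋀ z, z ∈ y ⇔ z ∈ x ⊔ z ≈ x.
Definition inductive a : O :=
  (⋁ z, is_empty z ⊓ z ∈ a) ⊓ (⋀ x, x ∈ a ⇒ ⋁ y, is_succ x y ⊓ y ∈ a).

Section Absoluteness.

Variable D : V -> O.
Hypothesis D_resp : respects D.
Hypothesis D_trans : forall s x y, le s (D y) -> le s (x ∈ y) -> le s (D x).

(** Here and in the next two lemmas the quantifiers over D are bounded by elements of D, so
    transitivity lets them range over V. *)
Lemma empty_in_absolute s x : le s (D x) -> le s (empty_in D x ⇔ is_empty x).
Proof.
move=> Dx; iiff => K.
  by apply: all_i => z; iimp => zx; apply: imp_e (allin_e K (D_trans Dx zx)) zx.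
by iallin => z _; apply: all_e K z.
Qed.

Lemma succ_in_absolute s x y : le s (D x) -> le s (D y) ->
  le s (succ_in D x y ⇔ is_succ x y).
Proof.
move=> Dx Dy; iiff => K; last by iallin => z _; apply: all_e K z.
apply: all_i => z; iiff => L.
  exact: iff_l (allin_e K (D_trans Dy L)) L.
have Dz : le s (D z).
  by ior L => L; [exact: D_trans L|exact: D_resp (eqv_sym L) Dx].
exact: iff_r (allin_e K Dz) L.
Qed.

Lemma inductive_in_absolute s a : le s (D a) -> le s (inductive_in D a ⇔ inductive a).
Proof.
move=> Da; iiff => /and_e[K L]; apply: and_i.
- iex K => z /and_e[Dz /and_e[Hz za]]; apply: (ex_i (i := z)).
  by apply: and_i za; apply: iff_l (empty_in_absolute Dz) Hz.
- apply: all_i => x; iimp => xa; have Dx := D_trans Da xa.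
  have {}L := imp_e (allin_e L Dx) xa; iex L => y /and_e[Dy /and_e[Hy ya]].
  by apply: (ex_i (i := y)); apply: and_i ya; apply: iff_l (succ_in_absolute Dx Dy) Hy.
- iex K => z /and_e[Hz za]; have Dz := D_trans Da za; apply: (exin_i Dz).
  by apply: and_i za; apply: iff_r (empty_in_absolute Dz) Hz.
iallin => x Dx; iimp => xa; have {}L := imp_e (all_e L x) xa; iex L => y /and_e[Hy ya].
have Dy := D_trans Da ya; apply: (exin_i Dy).
by apply: and_i ya; apply: iff_r (succ_in_absolute Dx Dy) Hy.
Qed.

End Absoluteness.

Hypothesis V_IZF : model_IZF (univ V).

(* A bounded definition of the elements of ω. *)
Definition natural n : O :=
  ⋀ k, k ∈ n ⊔ k ≈ n ⇒ is_empty k ⊔ ⋁ m, m ∈ k ⊓ is_succ m k.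

Lemma is_empty_congr s x y : le s (x ≈ y) -> le s (is_empty x) -> le s (is_empty y).
Proof.
by move=> H K; apply: all_i => z; iimp => L; apply: imp_e (all_e K z) (mem_r (eqv_sym H) L).
Qed.

Lemma is_empty_unique s x y : le s (is_empty x) -> le s (is_empty y) -> le s (x ≈ y).
Proof.
move=> H K; apply: (V_ext V_IZF); apply: all_i => z; iiff => L; apply: bot_e.
  exact: imp_e (all_e H z) L.
exact: imp_e (all_e K z) L.
Qed.

Lemma is_succ_congr s x y y' : le s (y ≈ y') -> le s (is_succ x y) -> le s (is_succ x y').
Proof.
move=> H K; apply: all_i => z; iiff => L.
  exact: iff_l (all_e K z) (mem_r (eqv_sym H) L).
exact: mem_r H (iff_r (all_e K z) L).
Qed.

Lemma V_omega s : le s (⋁ w, inductive w ⊓ ⋀ b, inductive b ⇒ ⋀ z, z ∈ w ⇒ z ∈ b).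
Proof.
have abs s' x : le s' (inductive_in (univ V) x ⇔ inductive x).
  by apply: inductive_in_absolute => [|*|]; [exact: respects_univ|exact: le_top|exact: le_top].
have K := le_trans (le_top s) (izf_strong_infinity V_IZF); iex K => w /and_r/and_e[Hw Kw].
apply: (ex_i (i := w)); apply: and_i; first exact: iff_l (abs _ _) Hw.
apply: all_i => b; iimp => Hb; apply: all_i => z; iimp.
apply: sub_univ_e; apply: (imp_e (allin_e Kw (le_top _))); exact: iff_r (abs _ _) Hb.
Qed.

(** The natural elements of w form an inductive set, and w is contained in every inductive set. *)
Lemma omega_natural s w n : le s (inductive w) ->
  le s (⋀ b, inductive b ⇒ ⋀ z, z ∈ w ⇒ z ∈ b) ->
  le s (n ∈ w) -> le s (natural n).
Proof.
move=> /and_e[W0 WS] Wmin nw.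
have K : le s (⋁ b, ⋀ x, x ∈ b ⇔ x ∈ w ⊓ natural x).
  by apply: (V_sep V_IZF); rewrite /natural /is_empty /is_succ; vdfn.
iex K => b Hb; apply: and_r (iff_l (all_e Hb n) _).
apply: (imp_e (all_e (imp_e (all_e Wmin b) _) n)) nw; apply: and_i.
  iex W0 => z /and_e[Hz zw]; apply: (ex_i (i := z)); apply: (and_i Hz).
  apply: (iff_r (all_e Hb z)); apply: (and_i zw); apply: all_i => k; iimp => K; apply: or_l.
  ior K => K; last exact: is_empty_congr (eqv_sym K) Hz.
  by apply: bot_e; apply: imp_e (all_e Hz k) K.
apply: all_i => x; iimp => xb; have [xw Nx] := and_e (iff_l (all_e Hb x) xb).
have K := imp_e (all_e WS x) xw; iex K => y /and_e[Hy yw]; apply: (ex_i (i := y)).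
apply: (and_i Hy); apply: (iff_r (all_e Hb y)); apply: (and_i yw).
apply: all_i => k; iimp => K; ior K => K.
  exact: imp_e (all_e Nx k) (iff_l (all_e Hy k) K).
apply: or_r; apply: (ex_i (i := x)); apply: and_i; last exact: is_succ_congr (eqv_sym K) Hy.
by apply: mem_r (eqv_sym K) _; apply: (iff_r (all_e Hy x)); apply/or_r/eqv_refl.
Qed.

(** Induction on ∈: n is empty or the successor of some m ∈ n, and m is again natural because every
    k with k ∈ m or k = m belongs to n. *)
Lemma natural_omega s w n : le s (inductive w) -> le s (natural n) -> le s (n ∈ w).
Proof.
move=> /and_e[W0 WS]; apply: imp_e; apply: (V_ind V_IZF (P := fun n => natural n ⇒ n ∈ w)).
  by rewrite /natural /is_empty /is_succ; vdfn.
apply: all_i => {}n; iimp => IH; iimp => Nn.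
have K := imp_e (all_e Nn n) (or_r _ (eqv_refl s n)); ior K => K.
  by iex W0 => z /and_e[Hz]; apply: mem_l; apply: is_empty_unique.
iex K => m /and_e[mn Hm].
have Nm : le s (natural m).
  apply: all_i => k; iimp => L; apply: (imp_e (all_e Nn k)); apply: or_l.
  by ior L => L; apply: (iff_r (all_e Hm k)); [apply: or_l|apply: or_r].
have mw := imp_e (imp_e (all_e IH m) mn) Nm.
have {}K := imp_e (all_e WS m) mw; iex K => y /and_e[Hy]; apply: mem_l.
exact: V_ext_in Hy Hm.
Qed.

End Infinity.

(** * Induction on formulas and Separation in M *)

Section Model.

Variables (O : cHeyting) (V : structure O) (M : V -> O).
Implicit Types (s : O) (x y z a b p q t v w : V).
Hypothesis V_IZF : model_IZF (univ V).
Hypothesis M_dfn : forall s (t : (nat -> V) -> V),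
  term (univ V) s t -> Dfn (univ V) s (fun e => M (t e)).
Hypothesis M_resp : respects M.
Hypothesis M_trans : forall s x y, le s (M y) -> le s (x ∈ y) -> le s (M x).
Hypothesis M_closed : closed_fundamental M.
Hypothesis M_inh : forall s, le s (sup M).
Hypothesis M_au : almost_universal M.

(** With Y from [quantifier_bound], a witness in M can be exchanged for one in Y. Adding Y as the
    bound of variable 0 gives a set of longer tuples, and its range removes the witness. *)
Lemma good_ex n (phi : form n.+1) : good M (sat M phi) ->
  good M (fun e => ⋁ x :in M, sat M phi (scons x e)).
Proof.
move=> Hphi s X MX.
have K := good_top V_IZF M_closed M_inh MX; iex K => T /and_e[MT HT].
have K := quantifier_bound V_IZF M_dfn M_resp M_au phi HT; iex K => Y /and_e[MY HY].
have MX' i : le s (M (scons Y X i)) by rewrite /scons; case: unlift.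
have K := Hphi s _ MX'; iex K => W /and_e[MW HW].
apply: inM_ext (inM_op M_closed Op_ran MW MW); apply: all_i => t; iiff => /= K.
  iex K => z /and_e[zW K]; iex K => c Hz.
  have {zW}K := tuples_cons_e (iff_l (all_e HW z) zW).
  iex K => v K; iex K => r /and_e[vY /and_e[Hz' K]]; rewrite scons0 in vY; rewrite tl_scons in K.
  have [_ rt] := opair_inj V_IZF Hz' Hz; apply: (tuples_eq rt); apply: tuples_mono K.
  by apply: all_i => e; iimp => K; apply: (exin_i (x := v)) K; apply: M_trans vY.
iex K => e /and_e[He /and_e[te K]]; iex K => v /and_e[Mv K].
have L := allin_e HY Mv; iex L => v' /and_e[vY L].
have {}K := iff_l (imp_e (all_e L e) He) K.
have L' := opair_ex V_IZF s v' t; iex L' => z Hz; apply: (ex_i (i := z)).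
apply: and_i; last exact: (ex_i (i := v')).
apply: (iff_r (all_e HW z)); apply: (tuples_cons_i _ Hz); first by rewrite scons0.
by rewrite tl_scons; apply: tuples_i te K; exact: all_e He.
Qed.

(** Every value in M behaves like one in Y, so it suffices that phi hold for all v ∈ Y. The set is T
    ∩ ⋂G, where G consists of the sections at v ∈ Y of the set W of longer tuples. *)
Lemma good_all n (phi : form n.+1) : good M (sat M phi) ->
  good M (fun e => ⋀ x :in M, sat M phi (scons x e)).
Proof.
move=> Hphi s X MX.
have K := good_top V_IZF M_closed M_inh MX; iex K => T /and_e[MT HT].
have K := quantifier_bound V_IZF M_dfn M_resp M_au phi HT; iex K => Y /and_e[MY HY].
have MX' i : le s (M (scons Y X i)) by rewrite /scons; case: unlift.
have K := Hphi s _ MX'; iex K => W /and_e[MW HW].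
have K := inM_op M_closed Op_sections MW MY; iex K => G /and_e[MG HG].
have K := inM_op M_closed Op_ran MW MW; iex K => R /and_e[MR HR].
apply: inM_ext (inM_op M_closed Op_bigcap MT MG); apply: all_i => t; iiff => /= K.
  have [tT {}K] := and_e K; have L := iff_l (all_e HT t) tT.
  iex L => e /and_e[He /and_e[te _]]; apply: (tuples_i _ te); first exact: all_e He.
  iallin => v Mv; have L := allin_e HY Mv; iex L => v' /and_e[vY L].
  apply: (iff_r (imp_e (all_e L e) He)).
  (* Membership in ⋂G can be applied at v' only once the section of W at v' is known to be a set; it
     is separated from the range of W. *)
  have {}L := @V_sep _ _ V_IZF s (fun u => opair_mem v' u W) R ltac:(vdfn); iex L => g Hg.
  have {}Hg : le s (⋀ u, u ∈ g ⇔ opair_mem v' u W).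
    apply: all_i => u; iiff => L; first exact: and_r (iff_l (all_e Hg u) L).
    apply: (iff_r (all_e Hg u)); apply: and_i (L); apply: (iff_r (all_e HR u)) => /=.
    iex L => p /and_e[Hp pW]; apply: (ex_i (i := p)); apply: (and_i pW).
    exact: (ex_i (i := v')).
  have gG : le s (g ∈ G).
    by apply: (iff_r (all_e HG g)); apply: (ex_i (i := v')); apply: and_i.
  have {}K := iff_l (all_e Hg t) (imp_e (all_e K g) gG); iex K => p /and_e[Hp pW].
  have {pW}K := iff_l (all_e HW p) pW.
  apply: (tuples_val V_IZF _ _ K); first exact: sat_congr.
  by apply: (ex_i (i := t)); rewrite scons0 tl_scons; apply: and_i.
iex K => e /and_e[He /and_e[te K]]; apply: and_i.
  by apply: (iff_r (all_e HT t)); apply: tuples_i te (le_top _); exact: all_e He.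
apply: all_i => g; iimp => gG; have L := iff_l (all_e HG g) gG; rewrite /= in L.
iex L => v /and_e[vY Hg]; apply: (iff_r (all_e Hg t)).
have L := opair_ex V_IZF s v t; iex L => p Hp; apply: (ex_i (i := p)); apply: (and_i Hp).
apply: (iff_r (all_e HW p)); apply: (tuples_cons_i _ Hp); first by rewrite scons0.
rewrite tl_scons; apply: tuples_i te (allin_e K (M_trans MY vY)); exact: all_e He.
Qed.

Lemma good_sat n (phi : form n) : good M (sat M phi).
Proof.
elim: phi => {n} [n i j|n i j|n|n f IHf g IHg|n f IHf g IHg|n f IHf g IHg|n f IHf|n f IHf].
- exact: good_mem.
- exact: good_eq.
- exact: good_bot.
- by apply: good_and => //; exact: sat_congr.
- exact: good_or.
- by apply: good_imp => //; exact: sat_congr.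
- exact: good_all.
- exact: good_ex.
Qed.

Lemma finite_choice s n (P : 'I_n -> V -> O) : (forall i, le s (⋁ x, P i x)) ->
  le s (sup (fun X : 'I_n -> V => ⋀ i, P i (X i))).
Proof.
elim: n s P => [|n IH] s P H.
  have K := M_inh s; iex K => x _; apply: (ex_i (i := fun _ => x)).
  by apply: all_i; case.
have K := H ord0; iex K => x Hx.
have K := IH s (fun i => P (lift ord0 i)) (fun i => H _); iex K => X HX.
apply: (ex_i (i := scons x X)); apply: all_i => i.
by case: (unliftP ord0 i) => [j|] ->; rewrite ?scons0 ?sconsS //; apply: all_e HX j.
Qed.

(** The bounds are a for the variable x and the singleton {e_i} for each parameter. Up to ≈, the
    tuples satisfying phi then carry exactly these parameters, and the domain of their set is the
    subset of a sought. *)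
Lemma M_sat_separation s n (phi : form n.+1) (e : 'I_n -> V) a :
  le s (M a) -> (forall i, le s (M (e i))) ->
  le s (inM M (fun x => x ∈ a ⊓ sat M phi (scons x e))).
Proof.
move=> Ma Me.
have K := finite_choice (fun i => inM_pair M_closed (Me i) (Me i)); iex K => X HX.
have MX i : le s (M (scons a X i)).
  by rewrite /scons; case: unlift => [j|] //; apply: and_l (all_e HX j).
have K := good_sat phi MX; iex K => W /and_e[MW HW].
have cong x : congruent (fun v : 'I_n -> V => sat M phi (scons x v)).
  move=> s' v v' Hv; apply: sat_congr => // i; rewrite /scons.
  by case: unlift => [j|] //; apply: eqv_refl.
apply: inM_ext (inM_op M_closed Op_dom MW MW); apply: all_i => x; iiff => /= K.
  iex K => z /and_e[zW K]; iex K => r Hz.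
  have {zW}K := tuples_cons_e (iff_l (all_e HW z) zW).
  iex K => u K; iex K => r' /and_e[ua /and_e[Hz' K]].
  have [ux _] := opair_inj V_IZF Hz' Hz; rewrite scons0 in ua; apply: and_i; first exact: mem_l ux ua.
  iex K => v /and_e[Hv /and_e[_ K]]; rewrite tl_scons in Hv.
  apply: sat_congr K => // i; rewrite /scons; case: unlift => [j|] //.
  have L := iff_l (all_e (and_r (all_e HX j)) (v j)) (all_e Hv j).
  by ior L.
have [xa {}K] := and_e K.
have L := tuple_ex V_IZF s e; iex L => r Hr; have L := opair_ex V_IZF s x r; iex L => z Hz.
apply: (ex_i (i := z)); apply: and_i; last exact: (ex_i (i := r)).
apply: (iff_r (all_e HW z)); apply: (tuples_cons_i _ Hz); first by rewrite scons0.
rewrite tl_scons; apply: tuples_i Hr K => i.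
exact: mem_pair_l (and_r (all_e HX i)).
Qed.

Lemma closed_separation n (phi : form n.+1) : ⊩ Separation M phi.
Proof.
apply: allin_i => s e _ Me; iallin => a Ma.
have K := M_sat_separation phi Ma (all_e Me); iex K => b /and_e[Mb Hb].
by apply: (exin_i Mb); iallin => x _; apply: all_e Hb x.
Qed.

End Model.

(** * The remaining axioms in M *)

Section Model.

Variables (O : cHeyting) (V : structure O) (M : V -> O).
Implicit Types (s : O) (x y z a b p q t v w : V).
Hypothesis V_IZF : model_IZF (univ V).
Hypothesis M_dfn : forall s (t : (nat -> V) -> V),
  term (univ V) s t -> Dfn (univ V) s (fun e => M (t e)).
Hypothesis M_resp : respects M.
Hypothesis M_trans : forall s x y, le s (M y) -> le s (x ∈ y) -> le s (M x).
Hypothesis M_closed : closed_fundamental M.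
Hypothesis M_inh : forall s, le s (sup M).
Hypothesis M_au : almost_universal M.

Lemma Dfn_sat1 s n (phi : form n.+1) (t : (nat -> V) -> V) (v : 'I_n -> V) :
  term (univ V) s t -> Dfn (univ V) s (fun e => sat M phi (scons (t e) v)).
Proof.
move=> Ht.
pose u (i : 'I_n.+1) (e : nat -> V) := if unlift ord0 i is Some j then v j else t e.
apply: (Dfn_ext (Dfn_sat M_dfn phi (u := u) _)).
  by move=> i; rewrite /u; case: unlift => [j|] //; apply: term_cst; apply: le_top.
move=> s' e l _; rewrite (_ : scons _ _ = (fun i => u i e)); first exact: iff_refl.
by apply: functional_extensionality => i; rewrite /scons /u; case: unlift.
Qed.

Lemma Dfn_sat2 s n (phi : form n.+2) (t t' : (nat -> V) -> V) (v : 'I_n -> V) :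
  term (univ V) s t -> term (univ V) s t' ->
  Dfn (univ V) s (fun e => sat M phi (scons (t e) (scons (t' e) v))).
Proof.
move=> Ht Ht'.
pose u (i : 'I_n.+2) (e : nat -> V) := if unlift ord0 i is Some j then
  (if unlift ord0 j is Some k then v k else t' e) else t e.
apply: (Dfn_ext (Dfn_sat M_dfn phi (u := u) _)).
  move=> i; rewrite /u; case: unlift => [j|] //; case: unlift => [k|] //.
  by apply: term_cst; apply: le_top.
move=> s' e l _; suff -> : scons (t e) (scons (t' e) v) = (fun i => u i e) by exact: iff_refl.
apply: functional_extensionality => i; rewrite /scons /u; by case: unlift.
Qed.

(** The subsets of x that lie in M form a set of V contained in M. A cover y ∈ M of it may be too
    large, and Separation in M keeps the z ∈ y with z ⊆ x. *)
Lemma closed_power_set : ⊩ PowerSet M.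
Proof.
apply: allin_i => s x _ Mx.
have K := V_power V_IZF s x; iex K => P HP.
have K := @V_sep _ _ V_IZF s M P ltac:(vdfn); iex K => P' HP'.
have K : le s (⋀ z, z ∈ P' ⇒ M z).
  by apply: all_i => z; iimp => zP; exact: and_r (iff_l (all_e HP' z) zP).
have {}K := M_cover M_au K; iex K => y /and_e[My Hy].
have K : le s (inM M (fun z => z ∈ y ⊓ ⋀ t, t ∈ z ⇒ t ∈ x)).
  apply: inM_sep My => //; first exact: closed_separation.
  apply: Dfn_all_in.
  - by apply: Dfn_mem; apply: term_var.
  - by apply: Dfn_mem; [apply: term_var|apply: term_cst].
  by move=> s' e t l He; apply: M_trans.
iex K => p /and_e[Mp Hp]; apply: (exin_i Mp); iallin => z Mz; iiff => K.
  by iallin => t _; apply: all_e (and_r (iff_l (all_e Hp z) K)) t.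
have {}K : le s (⋀ t, t ∈ z ⇒ t ∈ x).
  by apply: all_i => t; iimp => tz; apply: imp_e (allin_e K (M_trans Mz tz)) tz.
apply: (iff_r (all_e Hp z)); apply: and_i (K); apply: (imp_e (all_e Hy z)).
apply: (iff_r (all_e HP' z)); apply: and_i Mz; exact: iff_r (all_e HP z) K.
Qed.

Lemma inM_succ s x y : le s (M x) -> le s (is_succ x y) -> le s (M y).
Proof.
move=> Mx Hy; have K := inM_pair M_closed Mx Mx; iex K => w /and_e[Mw Hw].
have K := inM_union2 M_closed Mx Mw; iex K => z /and_e[Mz Hz].
apply: M_resp Mz; apply: (V_ext V_IZF); apply: all_i => t; iiff => K.
  apply: (iff_r (all_e Hy t)); have {}K := iff_l (all_e Hz t) K.
  by ior K => K; [apply: or_l|have {}K := iff_l (all_e Hw t) K; ior K => K; apply: or_r].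
apply: (iff_r (all_e Hz t)); have {}K := iff_l (all_e Hy t) K.
by ior K => K; [apply: or_l|apply: or_r; apply: (mem_pair Hw); apply: or_l].
Qed.

(** The set ω of V is contained in M. A cover of it in M is cut back by the bounded formula
    [natural], so that ω itself belongs to M; minimality passes to M because being inductive is
    absolute. *)
Lemma closed_strong_infinity : ⊩ StrongInfinity M.
Proof.
have K := V_omega V_IZF top; apply: (ex_e K) => {K} s w _ /and_e[Hw Wmin].
have K := @V_sep _ _ V_IZF s M w ltac:(vdfn); iex K => b Hb.
(* M contains ∅ and is closed under successors, so w ∩ M is inductive and minimality of w
   applies. *)
have wM : le s (⋀ z, z ∈ w ⇒ M z).
  apply: all_i => z; iimp => zw; apply: and_r (iff_l (all_e Hb z) _).
  apply: imp_e (all_e (imp_e (all_e Wmin b) _) z) zw; have [W0 WS] := and_e Hw.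
  apply: and_i.
    iex W0 => x /and_e[Hx xw]; apply: (ex_i (i := x)); apply: (and_i Hx).
    apply: (iff_r (all_e Hb x)); apply: (and_i xw).
    have K := inM_empty M_closed M_inh s; iex K => y /and_e[My Hy].
    by apply: M_resp My; apply: is_empty_unique.
  apply: all_i => x; iimp => xb; have [xw Mx] := and_e (iff_l (all_e Hb x) xb).
  have K := imp_e (all_e WS x) xw; iex K => y /and_e[Hy yw]; apply: (ex_i (i := y)).
  apply: (and_i Hy); apply: (iff_r (all_e Hb y)); apply: (and_i yw).
  exact: inM_succ Mx Hy.
have K := M_cover M_au wM; iex K => y /and_e[My Hy].
have K : le s (inM M (fun n => n ∈ y ⊓ natural n)).
  apply: inM_sep My => //; first exact: closed_separation.
  rewrite /natural /is_empty /is_succ.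
  apply: Dfn_all_in.
  - by apply: Dfn_or; [apply: Dfn_mem|apply: Dfn_eq]; apply: term_var.
  - apply: Dfn_or.
      apply: Dfn_all_in => [| |s' e z l He]; [|exact: Dfn_bot|exact: M_trans].
      by apply: Dfn_mem; apply: term_var.
    apply: Dfn_ex; last by move=> s' e z l He /and_l; apply: M_trans.
    apply: Dfn_and; first by apply: Dfn_mem; apply: term_var.
    apply: Dfn_all_iff => [| |s' e z l He|s' e z l He K].
    + by apply: Dfn_mem; apply: term_var.
    + by apply: Dfn_or; [apply: Dfn_mem|apply: Dfn_eq]; apply: term_var.
    + exact: M_trans.
    by ior K => K; [apply: M_trans K|apply: M_resp (eqv_sym K) _].
  by move=> s' e z l He K; ior K => K; [apply: M_trans K|apply: M_resp (eqv_sym K) _].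
iex K => w' /and_e[Mw' Hw'].
have Mw : le s (M w).
  apply: M_resp Mw'; apply: (V_ext V_IZF); apply: all_i => n; iiff => K.
    exact: (natural_omega V_IZF Hw (and_r (iff_l (all_e Hw' n) K))).
  apply: (iff_r (all_e Hw' n)); apply: and_i; first exact: imp_e (all_e Hy n) K.
  exact: (omega_natural V_IZF Hw Wmin K).
have abs s' x := @inductive_in_absolute _ _ M M_resp M_trans s' x.
apply: (exin_i Mw); apply: and_i; first exact: iff_r (abs _ _ Mw) Hw.
iallin => c Mc; iimp => Hc; iallin => z _.
exact: all_e (imp_e (all_e Wmin c) (iff_l (abs _ _ Mc) Hc)) z.
Qed.

Lemma closed_set_induction n (phi : form n.+1) : ⊩ SetInduction M phi.
Proof.
apply: allin_i => s e _ Me; iimp => H; iallin => a; apply: imp_e.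
apply: (V_ind V_IZF (P := fun a => M a ⇒ sat M phi (scons a e))).
  by vdfn; apply: Dfn_sat1; apply: term_var.
apply: all_i => b; iimp => K; iimp => Mb; apply: (imp_e (allin_e H Mb)).
iallin => x Mx; iimp => xb; exact: imp_e (imp_e (all_e K x) xb) Mx.
Qed.

(** Collection in V is applied to values in M, and the part of the result that lies in M is covered
    by an element of M. Extra elements of the cover do no harm, as Collection only asks for a
    superset of suitable values. *)
Lemma closed_collection n (phi : form n.+2) : ⊩ Collection M phi.
Proof.
apply: allin_i => s e _ Me; iallin => a Ma; iimp => H.
have K : le s (⋁ b, ⋀ x, x ∈ a ⇒ ⋁ y, y ∈ b ⊓ M y ⊓ sat M phi (scons x (scons y e))).
  apply: (V_coll V_IZF (P := fun x y => M y ⊓ sat M phi (scons x (scons y e)))).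
    by vdfn; apply: Dfn_sat2; apply: term_var.
  by apply: all_i => x; iimp => xa; exact: imp_e (allin_e H (M_trans Ma xa)) xa.
iex K => b Hb; have K := @V_sep _ _ V_IZF s M b ltac:(vdfn); iex K => b' Hb'.
have K : le s (⋀ z, z ∈ b' ⇒ M z).
  by apply: all_i => z; iimp => zP; exact: and_r (iff_l (all_e Hb' z) zP).
have {}K := M_cover M_au K; iex K => c /and_e[Mc Hc]; apply: (exin_i Mc).
iallin => x Mx; iimp => xa; have K := imp_e (all_e Hb x) xa.
iex K => y /and_e[yb /and_e[My K]]; apply: (exin_i My); apply: and_i K.
by apply: (imp_e (all_e Hc y)); apply: (iff_r (all_e Hb' y)); apply: and_i.
Qed.

Lemma closed_model_IZF : model_IZF M.
Proof.
split.
- apply: allin_i => s x _ Mx; iallin => y My; iimp => K; apply: (V_ext V_IZF).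
  apply: all_i => z; iiff => L.
    exact: iff_l (allin_e K (M_trans Mx L)) L.
  exact: iff_r (allin_e K (M_trans My L)) L.
- have K := inM_empty M_closed M_inh top; apply: (ex_e K) => {K} s x _ /and_e[Mx Hx].
  by apply: (exin_i Mx); iallin => z _; apply: all_e Hx z.
- apply: allin_i => s x _ Mx; iallin => y My.
  have K := inM_pair M_closed Mx My; iex K => z /and_e[Mz Hz]; apply: (exin_i Mz).
  by iallin => w _; apply: all_e Hz w.
- apply: allin_i => s x _ Mx.
  have K := inM_op M_closed Op_union Mx Mx; iex K => u /and_e[Mu Hu].
  apply: (exin_i Mu); iallin => z Mz; iiff => K.
    have {}K := iff_l (all_e Hu z) K; rewrite /= in K; iex K => y /and_e[yx zy].
    by apply: (exin_i (x := y)); [apply: M_trans yx|apply: and_i].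
  apply: (iff_r (all_e Hu z)) => /=; iex K => y /and_r; exact: (ex_i (i := y)).
- exact: closed_power_set.
- exact: closed_strong_infinity.
- exact: closed_set_induction.
- by move=> n phi; apply: closed_separation.
- exact: closed_collection.
Qed.

End Model.

(** * Transitive models are closed under the fundamental operations *)

Section Submodel.

Variables (O : cHeyting) (V : structure O) (M : V -> O).
Implicit Types (s : O) (x y z a b p q r t u v w : V).
Hypothesis V_IZF : model_IZF (univ V).
Hypothesis M_resp : respects M.
Hypothesis M_trans : forall s x y, le s (M y) -> le s (x ∈ y) -> le s (M x).
Hypothesis M_IZF : model_IZF M.

Lemma model_pair s x y : le s (M x) -> le s (M y) -> le s (⋁ w :in M, is_pair w x y).
Proof.
move=> Mx My; have K := allin_e (allin_e (le_trans (le_top s) (izf_pairing M_IZF)) Mx) My.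
iex K => w /and_e[Mw Hw]; apply: (exin_i Mw); apply: all_i => t; iiff => K.
  exact: iff_l (allin_e Hw (M_trans Mw K)) K.
apply: (iff_r (allin_e Hw _)) (K); ior K => K; exact: M_resp (eqv_sym K) _.
Qed.

Lemma model_is_pair s q x y : le s (M x) -> le s (M y) -> le s (is_pair q x y) -> le s (M q).
Proof.
move=> Mx My Hq; have K := model_pair Mx My; iex K => w /and_e[Mw Hw].
by apply: M_resp Mw; apply: is_pair_unique Hq.
Qed.

Lemma opair_is_pair s p q r x y : le s (is_opair p x y) -> le s (is_pair q x x) ->
  le s (is_pair r x y) -> le s (is_pair p q r).
Proof.
move=> Hp Hq Hr; apply: all_i => t; iiff => K.
  have {}K := iff_l (all_e Hp t) K; ior K => K; [apply: or_l|apply: or_r].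
    exact: (is_pair_unique V_IZF K Hq).
  exact: (is_pair_unique V_IZF K Hr).
apply: (iff_r (all_e Hp t)); ior K => K; [apply: or_l|apply: or_r].
  by apply: (V_subst (P := fun u => is_pair u x x)) (eqv_sym K) Hq; vdfn.
by apply: (V_subst (P := fun u => is_pair u x y)) (eqv_sym K) Hr; vdfn.
Qed.

Lemma model_is_opair s p x y : le s (M x) -> le s (M y) -> le s (is_opair p x y) -> le s (M p).
Proof.
move=> Mx My Hp.
have K := V_pair V_IZF s x x; iex K => q Hq; have K := V_pair V_IZF s x y; iex K => r Hr.
exact: model_is_pair (model_is_pair Mx Mx Hq) (model_is_pair Mx My Hr)
  (opair_is_pair Hp Hq Hr).
Qed.

Lemma model_union s x : le s (M x) -> le s (inM M (fun t => ⋁ z, z ∈ x ⊓ t ∈ z)).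
Proof.
move=> Mx; have K := allin_e (le_trans (le_top s) (izf_unions M_IZF)) Mx.
iex K => w /and_e[Mw Hw]; apply: (exin_i Mw); apply: all_i => t; iiff => K.
  have {}K := iff_l (allin_e Hw (M_trans Mw K)) K.
  iex K => y /and_r; exact: (ex_i (i := y)).
iex K => z /and_e[zx tz]; have Mz := M_trans Mx zx.
by apply: (iff_r (allin_e Hw (M_trans Mz tz))); apply: (exin_i Mz); apply: and_i.
Qed.

Lemma model_union2 s x y : le s (M x) -> le s (M y) ->
  le s (⋁ w :in M, ⋀ t, t ∈ x ⊔ t ∈ y ⇒ t ∈ w).
Proof.
move=> Mx My; have K := model_pair Mx My; iex K => p /and_e[Mp Hp].
have K := model_union Mp; iex K => w /and_e[Mw Hw]; apply: (exin_i Mw).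
apply: all_i => t; iimp => K; apply: (iff_r (all_e Hw t)).
ior K => K; [apply: (ex_i (i := x))|apply: (ex_i (i := y))]; apply: and_i K.
  exact: mem_pair_l Hp.
exact: mem_pair_r Hp.
Qed.

(** The power set of M captures only those subsets of x that belong to M, hence the guard on z. *)
Lemma model_power s x : le s (M x) ->
  le s (⋁ w :in M, ⋀ z :in M, (⋀ t, t ∈ z ⇒ t ∈ x) ⇒ z ∈ w).
Proof.
move=> Mx; have K := allin_e (le_trans (le_top s) (izf_power_set M_IZF)) Mx.
iex K => w /and_e[Mw Hw]; apply: (exin_i Mw); iallin => z Mz; iimp => K.
by apply: (iff_r (allin_e Hw Mz)); iallin => t _; apply: all_e K t.
Qed.

(** The bound is ⋃⋃x, since {a} and {a, b} are members of <a, b>. *)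
Lemma model_field s x : le s (M x) ->
  le s (⋁ w :in M, ⋀ a, ⋀ b, opair_mem a b x ⇒ a ∈ w ⊓ b ∈ w).
Proof.
move=> Mx; have K := model_union Mx; iex K => u /and_e[Mu Hu].
have K := model_union Mu; iex K => w /and_e[Mw Hw]; apply: (exin_i Mw).
apply: all_i => a; apply: all_i => b; iimp => K; iex K => p /and_e[Hp px].
have qu s1 q : le s1 (p ∈ x) -> le s1 (⋀ t, t ∈ u ⇔ ⋁ z, z ∈ x ⊓ t ∈ z) ->
    le s1 (q ∈ p) -> le s1 (q ∈ u).
  move=> px' Hu' qp; apply: (iff_r (all_e Hu' q)).
  by apply: (ex_i (i := p)); apply: and_i.
apply: and_i.
  have K := opair_mem_l (V_pair V_IZF) Hp; iex K => q /and_e[qp Hq].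
  apply: (iff_r (all_e Hw a)); apply: (ex_i (i := q)); apply: and_i; first exact: qu qp.
  exact: mem_pair_l Hq.
have K := opair_mem_r (V_pair V_IZF) Hp; iex K => q /and_e[qp Hq].
apply: (iff_r (all_e Hw b)); apply: (ex_i (i := q)); apply: and_i; first exact: qu qp.
exact: mem_pair_r Hq.
Qed.

Lemma model_bounded s (P : V -> O) a : Dfn M s (fun e => P (e 0)) -> le s (M a) ->
  le s (⋀ t, P t ⇒ t ∈ a) -> le s (inM M P).
Proof.
move=> HP Ma H; apply: inM_ext (inM_sep M_trans (izf_separation M_IZF) HP Ma).
apply: all_i => t; iiff => [/and_r //|K].
by apply: and_i (K); apply: imp_e (all_e H t) K.
Qed.

Ltac mfacts := first
  [ dterm | exact: M_trans | exact: M_resp | exact: model_is_pair | exact: (V_pair V_IZF) ].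

(** Shows that a set is in M by tracing it back to a set known to be there, through memberships and
    coordinates of ordered pairs. This discharges the boundedness conditions in [mdfn]. *)
Ltac mclose :=
  first
  [ assumption
  | match goal with He : forall k, le _ _ |- _ => apply: He end
  | match goal with H : le _ (?z ∈ ?y) |- le _ (M ?z) => solve [refine (M_trans _ H); mclose] end
  | match goal with H : le _ (is_opair ?p ?z _) |- le _ (M ?z) =>
      solve [refine (D_opair_l M_trans (V_pair V_IZF) _ H); mclose] end
  | match goal with H : le _ (is_opair ?p _ ?z) |- le _ (M ?z) =>
      solve [refine (D_opair_r M_trans (V_pair V_IZF) _ H); mclose] end ].

Ltac mopen :=
  repeat match goal with
  | H : le _ (sup _) |- _ =>
      let x := fresh "x" in let h := fresh "h" in iex H; intros x h
  | H : le _ (conj _ _) |- _ =>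
      let h1 := fresh "h" in let h2 := fresh "h" in
      destruct (and_e H) as [h1 h2]; clear H
  | H : le _ (opair_mem _ _ _) |- _ => unfold opair_mem in H
  | H : le _ (is_otriple _ _ _ _) |- _ => unfold is_otriple in H
  end.

Ltac mside :=
  let s' := fresh "s" in let e := fresh "e" in let z := fresh "z" in
  let l := fresh "l" in let He := fresh "He" in let h := fresh "h" in
  intros s' e z l He h; low l; cbv beta in h; mopen; mclose.

Ltac mdfn1 :=
  cbv beta;
  lazymatch goal with
  | |- Dfn _ _ (fun _ => sup _) => apply: Dfn_ex; [|mside]
  | |- Dfn _ _ (fun _ => inf (fun _ => iff_val _ _)) => apply: Dfn_all_iff; [| |mside|mside]
  | |- Dfn _ _ (fun _ => inf (fun _ => impl _ _)) => apply: Dfn_all_in; [| |mside]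
  | |- _ => dfn1 mfacts
  end.
Ltac mdfn := repeat mdfn1.

(** A pair <a, b> with a ∈ x and b ∈ y is a set of subsets of x ∪ y, so two power sets of M bound
    the product; the pair and its members are in M, as [model_power] requires. *)
Lemma model_prod s x y : le s (M x) -> le s (M y) -> le s (inM M (op_val Op_prod x y)).
Proof.
move=> Mx My; have K := model_union2 Mx My; iex K => u /and_e[Mu Hu].
have K := model_power Mu; iex K => v /and_e[Mv Hv].
have K := model_power Mv; iex K => w /and_e[Mw Hw].
apply: (model_bounded _ Mw); rewrite /op_val; first by mdfn.
apply: all_i => t; iimp => K; iex K => a K; iex K => b /and_e[ax /and_e[bx Ht]].
have Ma := M_trans Mx ax; have Mb := M_trans My bx; have Mt := model_is_opair Ma Mb Ht.
apply: (imp_e (allin_e Hw Mt)); apply: all_i => q; iimp => qt.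
apply: (imp_e (allin_e Hv (M_trans Mt qt))); apply: all_i => r; iimp => rq.
apply: (imp_e (all_e Hu r)); have K := iff_l (all_e Ht q) qt.
have {}K : le s (r ≈ a ⊔ r ≈ b).
  by ior K => K; have {}K := iff_l (all_e K r) rq; ior K => K; (exact: or_l || exact: or_r).
ior K => K; [apply: or_l|apply: or_r].
  exact: mem_l (eqv_sym K) ax.
exact: mem_l (eqv_sym K) bx.
Qed.

Lemma model_prod_bound s x y : le s (M x) -> le s (M y) ->
  le s (⋁ w :in M, ⋀ u, ⋀ v, ⋀ t, u ∈ x ⇒ v ∈ y ⇒ is_opair t u v ⇒ t ∈ w).
Proof.
move=> Mx My; have K := model_prod Mx My; iex K => w /and_e[Mw Hw]; apply: (exin_i Mw).
apply: all_i => u; apply: all_i => v; apply: all_i => t; iimp => ux; iimp => vy; iimp => Ht.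
apply: (iff_r (all_e Hw t)); apply: (ex_i (i := u)); apply: (ex_i (i := v)).
by do 2?apply: and_i.
Qed.

(** Each value has a bounded definition, so only a bound in M is needed. With F = ⋃⋃x it is F for
    domain and range, the power set of F for sections, F × (F × y) and F × (y × F) for the triples,
    and y × x for the relations ≈ and ∈. *)
Lemma model_op F s x y : le s (M x) -> le s (M y) -> le s (inM M (op_val F x y)).
Proof.
move=> Mx My; case: F.
- exact: model_pair.
- apply: (model_bounded _ Mx); rewrite /op_val; first by mdfn.
  by apply: all_i => t; iimp => /and_l.
- exact: model_union.
- apply: (model_bounded _ Mx); rewrite /op_val; first by mdfn.
  by apply: all_i => t; iimp => /and_l.
- exact: model_prod.
- apply: (model_bounded _ Mx); rewrite /op_val; first by mdfn.
  by apply: all_i => t; iimp => /and_l.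
- have K := model_field Mx; iex K => F /and_e[MF HF].
  have K := model_power MF; iex K => w /and_e[Mw Hw].
  apply: (model_bounded _ Mw); rewrite /op_val; first by mdfn.
  apply: all_i => t; iimp => K; iex K => z /and_e[zy Ht]; have Mz := M_trans My zy.
  (* The power set in M only sees sets of M, so the section is first obtained there by
     Separation. *)
  have K : le s (inM M (fun u => opair_mem z u x)).
    apply: (model_bounded _ MF); first by mdfn.
    by apply: all_i => u; iimp => K; apply: and_r (imp_e (all_e (all_e HF z) u) K).
  iex K => t' /and_e[Mt' Ht'].
  have Mt : le s (M t) by apply: M_resp Mt'; apply: V_ext_in Ht.
  apply: (imp_e (allin_e Hw Mt)); apply: all_i => u; iimp => ut.
  exact: and_r (imp_e (all_e (all_e HF z) u) (iff_l (all_e Ht u) ut)).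
- have K := model_field Mx; iex K => F /and_e[MF HF].
  apply: (model_bounded _ MF); rewrite /op_val; first by mdfn.
  apply: all_i => t; iimp => K; iex K => z /and_e[zx K]; iex K => b Hz.
  by apply: (and_l (imp_e (all_e (all_e HF t) b) _)); apply: (ex_i (i := z)); apply: and_i.
- have K := model_field Mx; iex K => F /and_e[MF HF].
  apply: (model_bounded _ MF); rewrite /op_val; first by mdfn.
  apply: all_i => t; iimp => K; iex K => z /and_e[zx K]; iex K => a Hz.
  by apply: (and_r (imp_e (all_e (all_e HF a) t) _)); apply: (ex_i (i := z)); apply: and_i.
- have K := model_field Mx; iex K => F /and_e[MF HF].
  have K := model_prod_bound MF My; iex K => w1 /and_e[Mw1 H1].
  have K := model_prod_bound MF Mw1; iex K => w2 /and_e[Mw2 H2].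
  apply: (model_bounded _ Mw2); rewrite /op_val; first by mdfn.
  apply: all_i => t; iimp => K; iex K => u K; iex K => v K; iex K => w /and_e[uv /and_e[wy K]].
  iex K => q /and_e[Hq Ht]; have [uF vF] := and_e (imp_e (all_e (all_e HF u) v) uv).
  apply: (imp_e (imp_e (imp_e (all_e (all_e (all_e H2 u) q) t) uF) _) Ht).
  exact: imp_e (imp_e (imp_e (all_e (all_e (all_e H1 v) w) q) vF) wy) Hq.
- have K := model_field Mx; iex K => F /and_e[MF HF].
  have K := model_prod_bound My MF; iex K => w1 /and_e[Mw1 H1].
  have K := model_prod_bound MF Mw1; iex K => w2 /and_e[Mw2 H2].
  apply: (model_bounded _ Mw2); rewrite /op_val; first by mdfn.
  apply: all_i => t; iimp => K; iex K => u K; iex K => v K; iex K => w /and_e[uv /and_e[wy K]].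
  iex K => q /and_e[Hq Ht]; have [uF vF] := and_e (imp_e (all_e (all_e HF u) v) uv).
  apply: (imp_e (imp_e (imp_e (all_e (all_e (all_e H2 u) q) t) uF) _) Ht).
  exact: imp_e (imp_e (imp_e (all_e (all_e (all_e H1 w) v) q) wy) vF) Hq.
- have K := model_prod_bound My Mx; iex K => w /and_e[Mw H].
  apply: (model_bounded _ Mw); rewrite /op_val; first by mdfn.
  apply: all_i => t; iimp => K; iex K => v K; iex K => u /and_e[vy /and_e[ux /and_e[Ht _]]].
  exact: imp_e (imp_e (imp_e (all_e (all_e (all_e H v) u) t) vy) ux) Ht.
- have K := model_prod_bound My Mx; iex K => w /and_e[Mw H].
  apply: (model_bounded _ Mw); rewrite /op_val; first by mdfn.
  apply: all_i => t; iimp => K; iex K => v K; iex K => u /and_e[vy /and_e[ux /and_e[Ht _]]].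
  exact: imp_e (imp_e (imp_e (all_e (all_e (all_e H v) u) t) vy) ux) Ht.
Qed.

End Submodel.

Theorem mainTheorem3 (O : cHeyting) (V : structure O) (M : V -> O)
    (V_IZF : model_IZF (univ V))
    (M_definable : definable_class M)
    (M_transitive : transitive_class M)
    (M_proper : proper_class M)
    (M_hierarchy : has_external_cumulative_hierarchy M) :
  model_IZF M <-> closed_fundamental M /\ almost_universal M.
Proof.
(* Being defined by a formula, M inherits the substitution of equals from satisfaction. *)
have M_resp : respects M.
  move=> s x y xy Mx; apply: (V_subst (P := M)) xy Mx.
  by apply: (Dfn_class M_definable); apply: term_var.
have M_trans s x y : le s (M y) -> le s (x ∈ y) -> le s (M x).
  by move=> My; exact: imp_e (all_e (allin_e (le_trans (le_top s) M_transitive) My) x).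
split=> [M_IZF|[M_closed M_au]].
  split=> [F|]; last exact: hierarchy_almost_universal M_hierarchy.
  by apply: allin_i => s x _ Mx; iallin => y My; apply: model_op.
apply: closed_model_IZF => //; first exact: Dfn_class.
by move=> s; apply: hierarchy_inhabited M_hierarchy.
Qed.
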